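(* Let $\mathbb{K}$ be a commutative unital ring and let $n\geq 2$ be a natural number. The associated algebra functor $\mathrm{U}\colon n\text{-}\mathsf{Lie}_{\mathbb{K}}\to \mathsf{Alg}_{\mathbb{K}}$ has a right adjoint if and only if $n=2$. More precisely, for $n>2$ there is no functor $F\colon n\text{-}\mathsf{Lie}_{\mathbb{K}}\to \mathsf{Alg}_{\mathbb{K}}$ with a right adjoint $G\colon \mathsf{Alg}_{\mathbb{K}}\to n\text{-}\mathsf{Lie}_{\mathbb{K}}$ such that for every $n$-Lie algebra $L$ there is an equivalence of categories between the category $L\text{-}\mathsf{Mod}_{\mathbb{K}}$ of $L$-modules and the category $\mathsf{Mod}_{F(L)}$ of modules over the associative algebra $F(L)$.
   Context: $\mathbb{K}$ is a commutative unital ring. An $n$-Lie algebra over $\mathbb{K}$ is a $\mathbb{K}$-module $L$ with an $n$-linear alternating bracket $[-,\dots,-]\colon L^n\to L$ (it vanishes whenever two of its arguments are equal) satisfying $$\big[[x_1,\dots,x_n],y_1,\dots,y_{n-1}\big]=\sum_{i=1}^n\big[x_1,\dots,x_{i-1},[x_i,y_1,\dots,y_{n-1}],x_{i+1},\dots,x_n\big]$$ for all $x_i,y_i\in L$. A homomorphism is a $\mathbb{K}$-linear map preserving the bracket; the resulting category is $n\text{-}\mathsf{Lie}_{\mathbb{K}}$. $\mathsf{Alg}_{\mathbb{K}}$ is the category of associative unital $\mathbb{K}$-algebras (and unital homomorphisms), and $\mathsf{Mod}_A$ is the category of (left) modules over $A$. An $L$-module is a $\mathbb{K}$-module $M$ together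 with an $n$-Lie algebra structure on $M\oplus L$ such that $L$ is a subalgebra, $M$ is an ideal (i.e. any bracket with an entry in $M$ lies in $M$), and the bracket is zero whenever two of its entries lie in $M$. A homomorphism of $L$-modules $f\colon M\to M'$ is a $\mathbb{K}$-linear map with $f([x_1,\dots,x_{n-1},m])=[x_1,\dots,x_{n-1},f(m)]$ for all $x_i\in L$, $m\in M$. This defines $L\text{-}\mathsf{Mod}_{\mathbb{K}}$. The associated algebra $\mathrm{U}(L)$ of an $n$-Lie algebra $L$ is the associative unital $\mathbb{K}$-algebra (the endomorphism algebra of the free $L$-module on one generator) explicitly given by the tensor algebra of the $\mathbb{K}$-module $\Lambda^{n-1}L$ modulo the two-sided ideal generated by the elements $$(x_1\wedge\cdots\wedge x_{n-1})(y_1\wedge\cdots\wedge y_{n-1})-(y_1\wedge\cdots\wedge y_{n-1})(x_1\wedge\cdots\wedge x_{n-1})-\sum_{i=1}^{n-1}y_1\wedge\cdots\wedge[x_1,\dots,x_{n-1},y_i]\wedge\cdots\wedge y_{n-1}$$ and $$[x_1,\dots,x_n]\wedge y_2\wedge\cdots\wedge y_{n-1}-\sum_{i=1}^{n}(-1)^{n-i}(x_1\wedge\cdots\wedge\widehat{x}_i\wedge\cdots\wedge x_n)(x_i\wedge y_2\wedge\cdots\wedge y_{n-1})$$ for $x_i,y_i\in L$. It is functorial in $L$ (a homomorphism $L\to L'$ induces $\Lambda^{n-1}L\to\Lambda^{n-1}L'$ and hence $\mathrm{U}(L)\to \mathrm{U}(L')$), and $L\text{-}\mathsf{Mod}_{\mathbb{K}}$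 is equivalent to $\mathsf{Mod}_{\mathrm{U}(L)}$ via $(x_1\wedge\cdots\wedge x_{n-1})m=[x_1,\dots,x_{n-1},m]$.
   Formalization: The commutative unital ring K is assumed nonzero: over the zero ring all n-Lie algebras, algebras and modules vanish, so U has a right adjoint (and all the equivalences hold) for every n, and the claim fails for n > 2. *)

(* Defs.v *)
From HB Require Import structures.
From mathcomp Require Import all_boot all_algebra.
From mathcomp Require Import boolp.
From mathcomp Require Import finmap monalg.

Set Implicit Arguments.
Unset Strict Implicit.
Unset Printing Implicit Defensive.

Import GRing.Theory.
Local Open Scope ring_scope.
Local Open Scope quotient_scope.

Record category := Category {
  obj :> Type;
  hom : obj -> obj -> Type;
  idm : forall X, hom X X;
  comp : forall X Y Z, hom Y Z -> hom X Y -> hom X Z;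
  comp_idl : forall X Y (f : hom X Y), comp (idm Y) f = f;
  comp_idr : forall X Y (f : hom X Y), comp f (idm X) = f;
  compA : forall X Y Z W (h : hom Z W) (g : hom Y Z) (f : hom X Y),
    comp h (comp g f) = comp (comp h g) f
}.
Arguments hom {c} X Y.
Arguments idm {c} X.
Arguments comp {c X Y Z} g f.

Record functor (C D : category) := Functor {
  fobj :> C -> D;
  fmap : forall X Y : C, hom X Y -> hom (fobj X) (fobj Y);
  fmap_id : forall X : C, fmap (idm X) = idm (fobj X);
  fmap_comp : forall (X Y Z : C) (g : hom Y Z) (f : hom X Y),
    fmap (comp g f) = comp (fmap g) (fmap f)
}.
Arguments fmap {C D} F {X Y} f : rename.

Definition id_functor (C : category) : functor C C :=
  @Functor C C (fun X => X) (fun X Y f => f)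
    (fun X => erefl) (fun X Y Z g f => erefl).

Section CompFunctor.
Variables (C D E : category) (G : functor D E) (F : functor C D).

Fact comp_functor_id (X : C) : fmap G (fmap F (idm X)) = idm (G (F X)).
Proof. by rewrite !fmap_id. Qed.

Fact comp_functor_comp (X Y Z : C) (g : hom Y Z) (f : hom X Y) :
  fmap G (fmap F (comp g f)) = comp (fmap G (fmap F g)) (fmap G (fmap F f)).
Proof. by rewrite !fmap_comp. Qed.

Definition comp_functor : functor C E :=
  @Functor C E (fun X => G (F X)) (fun X Y f => fmap G (fmap F f))
    comp_functor_id comp_functor_comp.
End CompFunctor.

Definition nat_iso (C D : category) (F G : functor C D) : Prop :=
  exists (a : forall X : C, hom (F X) (G X))
         (b : forall X : C, hom (G X) (F X)),
    [/\ forall (X Y : C) (f : hom X Y),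
          comp (a Y) (fmap F f) = comp (fmap G f) (a X),
        forall X, comp (b X) (a X) = idm (F X)
      & forall X, comp (a X) (b X) = idm (G X)].

Definition cat_equivalent (C D : category) : Prop :=
  exists (F : functor C D) (G : functor D C),
    nat_iso (comp_functor G F) (id_functor C) /\
    nat_iso (comp_functor F G) (id_functor D).

Definition adjoint (C D : category) (F : functor C D) (G : functor D C) : Prop :=
  exists phi : forall (X : C) (Y : D), hom (F X) Y -> hom X (G Y),
    (forall X Y, bijective (phi X Y)) /\
    (forall (X X' : C) (Y Y' : D) (f : hom X' X) (g : hom Y Y')
            (h : hom (F X) Y),
       phi X' Y' (comp g (comp h (fmap F f))) =
       comp (fmap G g) (comp (phi X Y h) f)).

Definition has_right_adjoint (C D : category) (F : functor C D) : Prop :=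
  exists G : functor D C, adjoint F G.

Lemma linear_ext (R : pzRingType) (U V : lmodType R) (f g : {linear U -> V}) :
  f =1 g -> f = g.
Proof.
case: f => f [[fD] [fZ]]; case: g => g [[gD] [gZ]] /= fg.
have /= {}fg := funext fg; case: g / fg in gD gZ *.
by rewrite (Prop_irrelevance fD gD) (Prop_irrelevance fZ gZ).
Qed.

Lemma rmorph_ext (R S : pzRingType) (f g : {rmorphism R -> S}) :
  f =1 g -> f = g.
Proof.
case: f => f [[fD] [fM]]; case: g => g [[gD] [gM]] /= fg.
have /= {}fg := funext fg; case: g / fg in gD gM *.
by rewrite (Prop_irrelevance fD gD) (Prop_irrelevance fM gM).
Qed.

Section ModCategory.
Variable A : pzRingType.

Definition lin_id (M : lmodType A) : {linear M -> M} := idfun.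
Definition lin_comp (M N P : lmodType A) (g : {linear N -> P})
  (f : {linear M -> N}) : {linear M -> P} := g \o f.

Fact lin_comp_idl (M N : lmodType A) (f : {linear M -> N}) : lin_comp (lin_id N) f = f.
Proof. exact: linear_ext. Qed.
Fact lin_comp_idr (M N : lmodType A) (f : {linear M -> N}) : lin_comp f (lin_id M) = f.
Proof. exact: linear_ext. Qed.
Fact lin_compA (M N P Q : lmodType A) (h : {linear P -> Q}) (g : {linear N -> P})
  (f : {linear M -> N}) : lin_comp h (lin_comp g f) = lin_comp (lin_comp h g) f.
Proof. exact: linear_ext. Qed.

Definition mod_cat : category :=
  @Category (lmodType A) (fun M N => {linear M -> N}) lin_id lin_comp
    lin_comp_idl lin_comp_idr lin_compA.
End ModCategory.

(* The library's [algType K] excludes the zero algebra, so a K-algebra is given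
   here as a ring together with its unit morphism from K to the center. *)

Record algebra (K : comNzRingType) := Algebra {
  alg_car :> pzRingType;
  alg_unit : {rmorphism K -> alg_car};
  alg_central : forall k a, alg_unit k * a = a * alg_unit k
}.
Arguments alg_unit {K} A : rename.

Record alg_hom (K : comNzRingType) (A B : algebra K) := AlgHom {
  alg_hom_fun :> {rmorphism A -> B};
  alg_hom_unit : forall k, alg_hom_fun (alg_unit A k) = alg_unit B k
}.

Lemma alg_hom_ext (K : comNzRingType) (A B : algebra K) (f g : alg_hom A B) :
  f =1 g -> f = g.
Proof.
case: f g => [f fK] [g gK] /= /rmorph_ext fg; case: g / fg in gK *.
by rewrite (Prop_irrelevance fK gK).
Qed.

Section AlgCategory.
Variable K : comNzRingType.

Definition alg_id (A : algebra K) : alg_hom A A :=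
  @AlgHom K A A idfun (fun=> erefl).

Fact alg_comp_subproof (A B C : algebra K) (g : alg_hom B C) (f : alg_hom A B)
  k : (g \o f) (alg_unit A k) = alg_unit C k.
Proof. by rewrite /= !alg_hom_unit. Qed.

Definition alg_comp (A B C : algebra K) (g : alg_hom B C) (f : alg_hom A B) :
  alg_hom A C := @AlgHom K A C (g \o f) (alg_comp_subproof g f).

Fact alg_comp_idl A B (f : alg_hom A B) : alg_comp (alg_id B) f = f.
Proof. exact: alg_hom_ext. Qed.
Fact alg_comp_idr A B (f : alg_hom A B) : alg_comp f (alg_id A) = f.
Proof. exact: alg_hom_ext. Qed.
Fact alg_compA A B C D (h : alg_hom C D) (g : alg_hom B C) (f : alg_hom A B) :
  alg_comp h (alg_comp g f) = alg_comp (alg_comp h g) f.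
Proof. exact: alg_hom_ext. Qed.

Definition alg_cat : category :=
  @Category (algebra K) (@alg_hom K) alg_id alg_comp
    alg_comp_idl alg_comp_idr alg_compA.
End AlgCategory.

Section ModuleQuotient.
Variables (K : pzRingType) (M : lmodType K) (S : M -> Prop).

Inductive span_of : M -> Prop :=
| span_gen s of S s : span_of s
| span_zero : span_of 0
| span_lin a u v of span_of u & span_of v : span_of (a *: u + v).

Definition span_pred : {pred M} := fun x => `[< span_of x >].

Fact span_zmod_closed : zmod_closed span_pred.
Proof.
split=> [|x y /asboolP xS /asboolP yS]; apply/asboolP; first exact: span_zero.
by rewrite addrC -scaleN1r; exact: span_lin.
Qed.
HB.instance Definition _ := GRing.isZmodClosed.Build M span_pred span_zmod_closed.

Definition module_quot := @Quotient.quot M span_pred.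
HB.instance Definition _ := GRing.Zmodule.on module_quot.

Definition mproj (x : M) : module_quot := \pi_module_quot x.

Lemma mproj_eq x y : mproj x = mproj y <-> span_of (x - y).
Proof.
rewrite /mproj; split=> [/eqP|xy]; first by rewrite -Quotient.idealrBE => /asboolP.
by apply/eqP; rewrite -Quotient.idealrBE; apply/asboolP.
Qed.

Lemma mproj_repr (q : module_quot) : mproj (repr q) = q.
Proof. exact: reprK. Qed.

Fact mproj_zmod_morphism : zmod_morphism mproj.
Proof. by move=> x y; rewrite /mproj raddfB. Qed.
HB.instance Definition _ :=
  GRing.isZmodMorphism.Build M module_quot mproj mproj_zmod_morphism.

Definition mq_scale (a : K) (q : module_quot) : module_quot :=
  mproj (a *: repr q).

Fact mq_scaleE a x : mq_scale a (mproj x) = mproj (a *: x).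
Proof.
apply/mproj_eq; rewrite -scalerBr -[_ *: _]addr0; apply: span_lin.
  by apply/mproj_eq; rewrite mproj_repr.
exact: span_zero.
Qed.

Fact mq_scaleA a b q : mq_scale a (mq_scale b q) = mq_scale (a * b) q.
Proof. by rewrite -[q]mproj_repr !mq_scaleE scalerA. Qed.
Fact mq_scale1 : left_id 1 mq_scale.
Proof. by move=> q; rewrite -[q]mproj_repr !mq_scaleE scale1r. Qed.
Fact mq_scaleDr : right_distributive mq_scale +%R.
Proof.
move=> a p q; rewrite -[p]mproj_repr -[q]mproj_repr -raddfD !mq_scaleE.
by rewrite scalerDr raddfD.
Qed.
Fact mq_scaleDl q : {morph mq_scale^~ q : a b / a + b}.
Proof.
by move=> a b; rewrite -[q]mproj_repr !mq_scaleE scalerDl raddfD.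
Qed.
HB.instance Definition _ := GRing.Zmodule_isLmodule.Build K module_quot
  mq_scaleA mq_scale1 mq_scaleDr mq_scaleDl.

Fact mproj_scalable : scalable mproj.
Proof. by move=> a x; rewrite -mq_scaleE. Qed.
HB.instance Definition _ :=
  GRing.isScalable.Build K M module_quot *:%R mproj mproj_scalable.

Lemma mproj_gen s : S s -> mproj s = 0.
Proof.
by move=> Ss; rewrite -(raddf0 mproj); apply/mproj_eq; rewrite subr0; apply: span_gen.
Qed.

Section Lift.
Variables (N : lmodType K) (f : {linear M -> N}).
Hypothesis fS : forall s, S s -> f s = 0.

Definition mlift (q : module_quot) : N := f (repr q).

Fact mlift_span z : span_of z -> f z = 0.
Proof.
elim=> [||a u v _ fu _ fv]; [exact: fS|exact: linear0|].
by rewrite linearP fu fv scaler0 addr0.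
Qed.

Fact mliftE x : mlift (mproj x) = f x.
Proof.
apply/eqP; rewrite -subr_eq0 -linearB; apply/eqP/mlift_span.
by apply/mproj_eq; rewrite mproj_repr.
Qed.

Fact mlift_linear : linear mlift.
Proof.
move=> a p q; rewrite -[p]mproj_repr -[q]mproj_repr -linearP !mliftE.
exact: linearP.
Qed.
HB.instance Definition _ :=
  GRing.isLinear.Build K module_quot N *:%R mlift mlift_linear.

Definition mod_lift : {linear module_quot -> N} := mlift.

Lemma mod_liftE x : mod_lift (mproj x) = f x.
Proof. exact: mliftE. Qed.
End Lift.
End ModuleQuotient.

Section AlgebraQuotient.
Variables (K : comNzRingType) (A : algebra K) (S : A -> Prop).

Inductive ideal_of : A -> Prop :=
| ideal_gen s of S s : ideal_of s
| ideal_zero : ideal_of 0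
| ideal_add u v of ideal_of u & ideal_of v : ideal_of (u + v)
| ideal_mull a u of ideal_of u : ideal_of (a * u)
| ideal_mulr a u of ideal_of u : ideal_of (u * a).

Definition ideal_pred : {pred A} := fun x => `[< ideal_of x >].

Fact ideal_zmod_closed : zmod_closed ideal_pred.
Proof.
split=> [|x y /asboolP xS /asboolP yS]; apply/asboolP; first exact: ideal_zero.
by apply: ideal_add => //; rewrite -mulN1r; exact: ideal_mull.
Qed.
HB.instance Definition _ := GRing.isZmodClosed.Build A ideal_pred ideal_zmod_closed.

Definition ring_quot := @Quotient.quot A ideal_pred.
HB.instance Definition _ := GRing.Zmodule.on ring_quot.

Definition qproj (x : A) : ring_quot := \pi_ring_quot x.

Lemma qproj_eq x y : qproj x = qproj y <-> ideal_of (x - y).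
Proof.
rewrite /qproj; split=> [/eqP|xy]; first by rewrite -Quotient.idealrBE => /asboolP.
by apply/eqP; rewrite -Quotient.idealrBE; apply/asboolP.
Qed.

Lemma qproj_repr (q : ring_quot) : qproj (repr q) = q.
Proof. exact: reprK. Qed.

Fact qproj_zmod_morphism : zmod_morphism qproj.
Proof. by move=> x y; rewrite /qproj raddfB. Qed.
HB.instance Definition _ :=
  GRing.isZmodMorphism.Build A ring_quot qproj qproj_zmod_morphism.

Definition rq_one : ring_quot := qproj 1.
Definition rq_mul (p q : ring_quot) : ring_quot := qproj (repr p * repr q).

Fact rq_mulE x y : rq_mul (qproj x) (qproj y) = qproj (x * y).
Proof.
apply/qproj_eq; set x' := repr _; set y' := repr _.
have -> : x' * y' - x * y = x' * (y' - y) + (x' - x) * y.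
  by rewrite mulrBr mulrBl addrA subrK.
apply: ideal_add; [apply: ideal_mull|apply: ideal_mulr];
  by apply/qproj_eq; rewrite qproj_repr.
Qed.

Fact rq_mulA : associative rq_mul.
Proof.
move=> p q r; rewrite -[p]qproj_repr -[q]qproj_repr -[r]qproj_repr !rq_mulE.
by rewrite mulrA.
Qed.
Fact rq_mul1l : left_id rq_one rq_mul.
Proof. by move=> p; rewrite -[p]qproj_repr rq_mulE mul1r. Qed.
Fact rq_mul1r : right_id rq_one rq_mul.
Proof. by move=> p; rewrite -[p]qproj_repr rq_mulE mulr1. Qed.
Fact rq_mulDl : left_distributive rq_mul +%R.
Proof.
move=> p q r; rewrite -[p]qproj_repr -[q]qproj_repr -[r]qproj_repr.
by rewrite -raddfD !rq_mulE mulrDl raddfD.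
Qed.
Fact rq_mulDr : right_distributive rq_mul +%R.
Proof.
move=> p q r; rewrite -[p]qproj_repr -[q]qproj_repr -[r]qproj_repr.
by rewrite -raddfD !rq_mulE mulrDr raddfD.
Qed.
HB.instance Definition _ := GRing.Zmodule_isPzRing.Build ring_quot
  rq_mulA rq_mul1l rq_mul1r rq_mulDl rq_mulDr.

Fact qproj_monoid_morphism : monoid_morphism qproj.
Proof. by split=> // x y; rewrite -rq_mulE. Qed.
HB.instance Definition _ :=
  GRing.isMonoidMorphism.Build A ring_quot qproj qproj_monoid_morphism.

Fact alg_quot_central k (q : ring_quot) :
  (qproj \o alg_unit A) k * q = q * (qproj \o alg_unit A) k.
Proof. by rewrite -[q]qproj_repr /= -!rmorphM alg_central. Qed.

Definition alg_quot : algebra K :=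
  @Algebra K ring_quot (qproj \o alg_unit A) alg_quot_central.

Definition alg_proj : alg_hom A alg_quot :=
  @AlgHom K A alg_quot qproj (fun=> erefl).

Lemma alg_proj_gen s : S s -> alg_proj s = 0.
Proof.
by move=> Ss; rewrite -(raddf0 alg_proj); apply/qproj_eq; rewrite subr0; apply: ideal_gen.
Qed.

Lemma alg_proj_surj (q : alg_quot) : exists x, q = alg_proj x.
Proof. by exists (repr q); rewrite /= qproj_repr. Qed.

Section Lift.
Variables (B : algebra K) (f : alg_hom A B).
Hypothesis fS : forall s, S s -> f s = 0.

Definition qlift (q : ring_quot) : B := f (repr q).

Fact qlift_ideal z : ideal_of z -> f z = 0.
Proof.
elim=> [||u v _ fu _ fv|a u _ fu|a u _ fu]; [exact: fS|exact: rmorph0|..].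
- by rewrite rmorphD fu fv addr0.
- by rewrite rmorphM fu mulr0.
- by rewrite rmorphM fu mul0r.
Qed.

Fact qliftE x : qlift (qproj x) = f x.
Proof.
apply/eqP; rewrite -subr_eq0 -rmorphB; apply/eqP/qlift_ideal.
by apply/qproj_eq; rewrite qproj_repr.
Qed.

Fact qlift_zmod_morphism : zmod_morphism qlift.
Proof.
by move=> p q; rewrite -[p]qproj_repr -[q]qproj_repr -raddfB !qliftE raddfB.
Qed.
HB.instance Definition _ :=
  GRing.isZmodMorphism.Build ring_quot B qlift qlift_zmod_morphism.

Fact qlift_monoid_morphism : monoid_morphism qlift.
Proof.
split=> [|p q]; first by rewrite -(rmorph1 qproj) qliftE rmorph1.
by rewrite -[p]qproj_repr -[q]qproj_repr -rmorphM !qliftE rmorphM.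
Qed.
HB.instance Definition _ :=
  GRing.isMonoidMorphism.Build ring_quot B qlift qlift_monoid_morphism.

Fact qlift_unit k : qlift (alg_unit alg_quot k) = alg_unit B k.
Proof. by rewrite /= qliftE alg_hom_unit. Qed.

Definition alg_lift : alg_hom alg_quot B := @AlgHom K alg_quot B qlift qlift_unit.

Lemma alg_liftE x : alg_lift (alg_proj x) = f x.
Proof. exact: qliftE. Qed.
End Lift.
End AlgebraQuotient.

(* The free algebra on X, as the monoid algebra of the free monoid on X. *)

Section FreeAlgebra.
Variables (K : comNzRingType) (X : choiceType).

Fact free_alg_central (k : K) (g : {malg K[{fmonom X}]}) :
  malgC k * g = g * malgC k.
Proof.
rewrite !malgM_def fgmulUg fgmulgU; apply: eq_bigr => m _.
by rewrite mul1m mulm1 mulrC.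
Qed.

Definition free_alg : algebra K :=
  @Algebra K {malg K[{fmonom X}]} (malgC : K -> {malg K[{fmonom X}]}) free_alg_central.

Definition free_gen (x : X) : free_alg := mkmalgU (fmu x) 1.

Section Lift.
Variables (B : algebra K) (f : X -> B).

Definition free_word (m : {fmonom X}) : B := \prod_(x <- m) f x.

Definition free_lift_fun (g : {malg K[{fmonom X}]}) : B :=
  \sum_(m <- msupp g) alg_unit B (mcoeff m g) * free_word m.

Fact free_lift_funEw (d : {fset {fmonom X}}) g : (msupp g `<=` d)%fset ->
  free_lift_fun g = \sum_(m <- d) alg_unit B (mcoeff m g) * free_word m.
Proof.
move=> le; rewrite [LHS](big_fset_incl _ le) => //= m md /mcoeff_outdom ->.
by rewrite raddf0 mul0r.
Qed.

Fact free_lift_funU c m :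
  free_lift_fun (mkmalgU m c) = alg_unit B c * free_word m.
Proof. by rewrite (free_lift_funEw msuppU_le) big_seq_fset1 mcoeffUU. Qed.

Fact free_lift_zmod_morphism : zmod_morphism free_lift_fun.
Proof.
move=> g h; pose d := (msupp g `|` msupp h)%fset.
rewrite (@free_lift_funEw d (g - h)) ?msuppB_le //.
rewrite (@free_lift_funEw d g) ?fsubsetUl // (@free_lift_funEw d h) ?fsubsetUr //.
by rewrite -sumrB; apply/eq_bigr=> m _; rewrite !raddfB /= mulrBl.
Qed.
HB.instance Definition _ :=
  GRing.isZmodMorphism.Build {malg K[{fmonom X}]} B free_lift_fun
    free_lift_zmod_morphism.

Fact free_lift_monoid_morphism : monoid_morphism free_lift_fun.
Proof.
split=> [|g h].
  by rewrite free_lift_funU rmorph1 mul1r /free_word fm1 big_nil.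
rewrite malgME raddf_sum mulr_suml /=; apply: eq_bigr=> i _.
rewrite raddf_sum mulr_sumr /=; apply: eq_bigr=> j _.
rewrite free_lift_funU rmorphM /free_word fmM big_cat /= -!mulrA.
by congr (_ * _); rewrite !mulrA alg_central.
Qed.
HB.instance Definition _ :=
  GRing.isMonoidMorphism.Build {malg K[{fmonom X}]} B free_lift_fun
    free_lift_monoid_morphism.

Fact free_lift_unit k : free_lift_fun (alg_unit free_alg k) = alg_unit B k.
Proof. by rewrite /= free_lift_funU /free_word fm1 big_nil mulr1. Qed.

Definition free_lift : alg_hom free_alg B :=
  @AlgHom K free_alg B free_lift_fun free_lift_unit.

Lemma free_liftE x : free_lift (free_gen x) = f x.
Proof. by rewrite /= free_lift_funU rmorph1 mul1r /free_word fmU big_seq1. Qed.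
End Lift.

Lemma free_alg_ext (B : algebra K) (f g : alg_hom free_alg B) :
  (forall x, f (free_gen x) = g (free_gen x)) -> f = g.
Proof.
move=> fg; apply: alg_hom_ext => h; rewrite [h]monalgE !rmorph_sum.
apply: eq_bigr => m _; set c := mcoeff m h.
have -> : mkmalgU m c = alg_unit free_alg c * mkmalgU m 1 :> free_alg.
  by rewrite /= malgM_def fgmulUU mulr1 mul1m.
rewrite !rmorphM !alg_hom_unit; congr (_ * _); case: m {c} => s.
elim: s => [|x s IHs].
  have -> : mkmalgU (FMonom [::]) 1 = 1 :> free_alg by rewrite -fmoneE.
  by rewrite !rmorph1.
have -> : mkmalgU (FMonom (x :: s)) 1 = free_gen x * mkmalgU (FMonom s) 1
            :> free_alg.
  rewrite /free_gen /= malgM_def fgmulUU mulr1; congr (mkmalgU _ 1).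
  by apply/val_inj; rewrite /= fmM fmU.
by rewrite !rmorphM fg IHs.
Qed.
End FreeAlgebra.

Lemma alg_quot_ext (K : comNzRingType) (A : algebra K) (S : A -> Prop)
    (B : algebra K) (f g : alg_hom (alg_quot S) B) :
  (forall x, f (alg_proj S x) = g (alg_proj S x)) -> f = g.
Proof.
by move=> fg; apply: alg_hom_ext => q; have [x ->] := alg_proj_surj q.
Qed.

(* The tensor algebra T(V), as the free algebra on the elements of V modulo the
   K-linearity of the insertion of generators. *)

Section TensorAlgebra.
Variables (K : comNzRingType) (V : lmodType K).

Inductive tensor_rel : free_alg K V -> Prop :=
| TensorRel (a : K) (u v : V) :
    tensor_rel (free_gen K (a *: u + v)
                - (alg_unit (free_alg K V) a * free_gen K u + free_gen K v)).

Definition tensor_alg : algebra K := alg_quot tensor_rel.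

Definition tensor_gen (v : V) : tensor_alg := alg_proj tensor_rel (free_gen K v).

Lemma tensor_gen_linear a u v :
  tensor_gen (a *: u + v)
  = alg_unit tensor_alg a * tensor_gen u + tensor_gen v.
Proof.
apply/eqP; rewrite -subr_eq0 -[alg_unit _ a](alg_hom_unit (alg_proj _)).
by rewrite -rmorphM -rmorphD -rmorphB; apply/eqP/alg_proj_gen.
Qed.

Section Lift.
Variables (B : algebra K) (f : V -> B).
Hypothesis f_linear : forall a u v, f (a *: u + v) = alg_unit B a * f u + f v.

Fact tensor_lift_subproof s : tensor_rel s -> free_lift f s = 0.
Proof.
case=> a u v; rewrite rmorphB rmorphD rmorphM !free_liftE alg_hom_unit.
by rewrite f_linear subrr.
Qed.

Definition tensor_lift : alg_hom tensor_alg B := alg_lift tensor_lift_subproof.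

Lemma tensor_liftE v : tensor_lift (tensor_gen v) = f v.
Proof. by rewrite /tensor_lift alg_liftE free_liftE. Qed.
End Lift.

Lemma tensor_alg_ext (B : algebra K) (f g : alg_hom tensor_alg B) :
  (forall v, f (tensor_gen v) = g (tensor_gen v)) -> f = g.
Proof.
move=> fg; apply: alg_quot_ext => x.
exact: (congr1 (fun h : alg_hom _ _ => h x)
  (@free_alg_ext _ _ _ (alg_comp f (alg_proj _)) (alg_comp g (alg_proj _)) fg)).
Qed.
End TensorAlgebra.

Section Families.
Variable T : Type.

Definition upd (m : nat) (x : 'I_m -> T) (i : 'I_m) (a : T) : 'I_m -> T :=
  fun k => if k == i then a else x k.

(* (a, y_1, ..., y_{n-1}) and (y_1, ..., y_{n-1}, a); the default value [a] of
   [nth] is never used when 0 < n. *)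
Definition cons_fam (n : nat) (a : T) (y : 'I_n.-1 -> T) : 'I_n -> T :=
  fun k => nth a (a :: codom y) k.

Definition rcons_fam (n : nat) (y : 'I_n.-1 -> T) (a : T) : 'I_n -> T :=
  fun k => nth a (rcons (codom y) a) k.
End Families.

Lemma comp_upd (T U : Type) (f : T -> U) m (x : 'I_m -> T) i a :
  f \o upd x i a = upd (f \o x) i (f a).
Proof. by apply: funext => k; rewrite /upd /=; case: ifP. Qed.

Lemma comp_cons_fam (T U : Type) (f : T -> U) n a (y : 'I_n.-1 -> T) :
  f \o cons_fam a y = cons_fam (f a) (f \o y).
Proof.
apply: funext => k; rewrite /cons_fam /= [codom (f \o y)]codomE map_comp -codomE.
by case: (k : nat) => //= j; elim: (codom y) j => [|b s IHs] [|j] /=.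
Qed.

Lemma comp_rcons_fam (T U : Type) (f : T -> U) n (y : 'I_n.-1 -> T) a :
  f \o rcons_fam y a = rcons_fam (f \o y) (f a).
Proof.
apply: funext => k; rewrite /rcons_fam /= [codom (f \o y)]codomE map_comp -codomE.
by rewrite -map_rcons; elim: (rcons _ _) (k : nat) => [|b s IHs] [|j] /=.
Qed.

Section Multilinear.
Variables (K : pzRingType) (V W : lmodType K) (m : nat) (f : ('I_m -> V) -> W).

Definition multilinear : Prop :=
  forall x i a u v, f (upd x i (a *: u + v)) = a *: f (upd x i u) + f (upd x i v).

Definition alternating : Prop :=
  forall x i j, i != j -> x i = x j -> f x = 0.
End Multilinear.

(* The exterior power of degree m, as the free module on m-tuples modulo
   multilinearity and alternation. *)

Section ExteriorPower.
Variables (K : comNzRingType) (m : nat) (V : lmodType K).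

Definition free_tuple (x : 'I_m -> V) : {malg K[{ffun 'I_m -> V}]} :=
  mkmalgU (finfun x) 1.

Inductive ext_rel : {malg K[{ffun 'I_m -> V}]} -> Prop :=
| ExtLinear x i a u v :
    ext_rel (free_tuple (upd x i (a *: u + v))
             - (a *: free_tuple (upd x i u) + free_tuple (upd x i v)))
| ExtAlternating x i j of i != j & x i = x j : ext_rel (free_tuple x).

Definition ext_power : lmodType K := module_quot ext_rel.

Definition wedge (x : 'I_m -> V) : ext_power := mproj ext_rel (free_tuple x).

Lemma wedge_multilinear : multilinear wedge.
Proof.
move=> x i a u v; apply/eqP; rewrite -subr_eq0 -linearP -raddfB.
by apply/eqP/mproj_gen; constructor.
Qed.

Lemma wedge_alternating : alternating wedge.
Proof. by move=> x i j ij xij; apply: mproj_gen; apply: ExtAlternating ij xij. Qed.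

Lemma ext_power_ind (P : ext_power -> Prop) :
  P 0 -> (forall a x v, P v -> P (a *: wedge x + v)) -> forall v, P v.
Proof.
move=> P0 PD v; rewrite -[v]mproj_repr [repr v]monalgE.
elim: (msupp (repr v) : seq _) => [|x s IHs]; first by rewrite big_nil raddf0.
have e : mkmalgU x (mcoeff x (repr v)) = mcoeff x (repr v) *: free_tuple x.
  apply/malgP => k; rewrite mcoeffZ !mcoeffU mulr_natr.
  by have -> : finfun x = x by apply/ffunP => ?; rewrite ffunE.
by rewrite big_cons e linearP; apply: PD.
Qed.
End ExteriorPower.

Section ExtMap.
Variables (K : comNzRingType) (m : nat) (V W : lmodType K) (f : {linear V -> W}).

Definition ext_map_free (g : {malg K[{ffun 'I_m -> V}]}) : ext_power m W :=
  \sum_(x <- msupp g) mcoeff x g *: wedge (f \o x).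

Fact ext_map_freeEw (d : {fset {ffun 'I_m -> V}}) g : (msupp g `<=` d)%fset ->
  ext_map_free g = \sum_(x <- d) mcoeff x g *: wedge (f \o x).
Proof.
move=> le; rewrite [LHS](big_fset_incl _ le) => //= x md /mcoeff_outdom ->.
by rewrite scale0r.
Qed.

Fact ext_map_free_linear : linear ext_map_free.
Proof.
move=> a g h; pose d := (msupp (a *: g + h) `|` (msupp g `|` msupp h))%fset.
have gd : (msupp g `<=` d)%fset.
  by apply: fsubset_trans (fsubsetUr _ _); apply: fsubsetUl.
have hd : (msupp h `<=` d)%fset.
  by apply: fsubset_trans (fsubsetUr _ _); apply: fsubsetUr.
have sd : (msupp (a *: g + h) `<=` d)%fset by exact: fsubsetUl.
rewrite (ext_map_freeEw sd) (ext_map_freeEw gd) (ext_map_freeEw hd).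
rewrite scaler_sumr -big_split; apply/eq_bigr=> x _.
by rewrite mcoeffD mcoeffZ scalerDl scalerA.
Qed.
HB.instance Definition _ :=
  GRing.isLinear.Build K {malg K[{ffun 'I_m -> V}]} (ext_power m W) *:%R
    ext_map_free ext_map_free_linear.

Fact ext_map_freeE x : ext_map_free (free_tuple x) = wedge (f \o x).
Proof.
rewrite (ext_map_freeEw msuppU_le) big_seq_fset1 mcoeffUU scale1r.
by congr wedge; apply: funext => i /=; rewrite ffunE.
Qed.

Fact ext_map_subproof s : ext_rel s -> ext_map_free s = 0.
Proof.
case=> [x i a u v|x i j ij xij].
  rewrite linearB linearP /= !ext_map_freeE !comp_upd linearP.
  by rewrite wedge_multilinear subrr.
by rewrite ext_map_freeE (wedge_alternating ij) //= xij.
Qed.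

Definition ext_map : {linear ext_power m V -> ext_power m W} :=
  mod_lift ext_map_subproof.

Lemma ext_mapE x : ext_map (wedge x) = wedge (f \o x).
Proof. by rewrite /ext_map mod_liftE /= ext_map_freeE. Qed.
End ExtMap.

(* Only n >= 2 is meaningful: for smaller n the family sizes degenerate. *)

Section NLieAxioms.
Variables (K : comNzRingType) (n : nat) (L : lmodType K).

Definition fundamental_identity (br : ('I_n -> L) -> L) : Prop :=
  forall (x : 'I_n -> L) (y : 'I_n.-1 -> L),
    br (cons_fam (br x) y) =
    \sum_(i < n) br (upd x i (br (cons_fam (x i) y))).

Definition is_nLie (br : ('I_n -> L) -> L) : Prop :=
  [/\ multilinear br, alternating br & fundamental_identity br].
End NLieAxioms.

Record nLie (K : comNzRingType) (n : nat) := NLie {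
  nLie_car :> lmodType K;
  bracket : ('I_n -> nLie_car) -> nLie_car;
  bracket_nLie : is_nLie bracket
}.
Arguments bracket {K n L} x : rename.

Record nLie_hom (K : comNzRingType) (n : nat) (L L' : nLie K n) := NLieHom {
  nLie_hom_fun :> {linear L -> L'};
  nLie_hom_bracket : forall x : 'I_n -> L,
    nLie_hom_fun (bracket x) = bracket (nLie_hom_fun \o x)
}.

Section NLieCategory.
Variables (K : comNzRingType) (n : nat).

Lemma nLie_hom_ext (L L' : nLie K n) (f g : nLie_hom L L') : f =1 g -> f = g.
Proof.
case: f g => [f fP] [g gP] /= /linear_ext fg; case: g / fg in gP *.
by rewrite (Prop_irrelevance fP gP).
Qed.

Definition nLie_id (L : nLie K n) : nLie_hom L L :=
  @NLieHom K n L L idfun (fun=> erefl).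

Fact nLie_comp_subproof (L L' L'' : nLie K n) (g : nLie_hom L' L'')
    (f : nLie_hom L L') (x : 'I_n -> L) :
  (g \o f) (bracket x) = bracket ((g \o f) \o x).
Proof. by rewrite /= !nLie_hom_bracket. Qed.

Definition nLie_comp (L L' L'' : nLie K n) (g : nLie_hom L' L'')
    (f : nLie_hom L L') : nLie_hom L L'' :=
  @NLieHom K n L L'' (g \o f) (nLie_comp_subproof g f).

Fact nLie_comp_idl L L' (f : nLie_hom L L') : nLie_comp (nLie_id L') f = f.
Proof. exact: nLie_hom_ext. Qed.
Fact nLie_comp_idr L L' (f : nLie_hom L L') : nLie_comp f (nLie_id L) = f.
Proof. exact: nLie_hom_ext. Qed.
Fact nLie_compA L1 L2 L3 L4 (h : nLie_hom L3 L4) (g : nLie_hom L2 L3)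
    (f : nLie_hom L1 L2) :
  nLie_comp h (nLie_comp g f) = nLie_comp (nLie_comp h g) f.
Proof. exact: nLie_hom_ext. Qed.

Definition nLie_cat : category :=
  @Category (nLie K n) (@nLie_hom K n) nLie_id nLie_comp
    nLie_comp_idl nLie_comp_idr nLie_compA.
End NLieCategory.

(* An L-module structure on M is an n-Lie structure on M (+) L = M * L. *)

Record Lmodule (K : comNzRingType) (n : nat) (L : nLie K n) := LModule {
  lmod_car :> lmodType K;
  lmod_bracket : ('I_n -> lmod_car * L) -> lmod_car * L;
  lmod_nLie : is_nLie lmod_bracket;
  lmod_subalgebra : forall x : 'I_n -> L,
    lmod_bracket (fun i => (0, x i)) = (0, bracket x);
  lmod_ideal : forall (z : 'I_n -> lmod_car * L) i,
    (z i).2 = 0 -> (lmod_bracket z).2 = 0;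
  lmod_abelian : forall (z : 'I_n -> lmod_car * L) i j,
    i != j -> (z i).2 = 0 -> (z j).2 = 0 -> lmod_bracket z = 0
}.
Arguments lmod_bracket {K n L} M z : rename.

(* The component in M of [x_1, ..., x_{n-1}, m]; the component in L is 0 by
   [lmod_ideal]. *)
Definition act (K : comNzRingType) (n : nat) (L : nLie K n) (M : Lmodule L)
    (x : 'I_n.-1 -> L) (m : M) : M :=
  (lmod_bracket M (rcons_fam (fun i => (0, x i)) (m, 0))).1.

Record Lmodule_hom (K : comNzRingType) (n : nat) (L : nLie K n)
    (M N : Lmodule L) := LModuleHom {
  lmod_hom_fun :> {linear M -> N};
  lmod_hom_act : forall (x : 'I_n.-1 -> L) (m : M),
    lmod_hom_fun (act x m) = act x (lmod_hom_fun m)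
}.

Section LmoduleCategory.
Variables (K : comNzRingType) (n : nat) (L : nLie K n).

Lemma Lmodule_hom_ext (M N : Lmodule L) (f g : Lmodule_hom M N) :
  f =1 g -> f = g.
Proof.
case: f g => [f fP] [g gP] /= /linear_ext fg; case: g / fg in gP *.
by rewrite (Prop_irrelevance fP gP).
Qed.

Definition Lmodule_id (M : Lmodule L) : Lmodule_hom M M :=
  @LModuleHom K n L M M idfun (fun _ _ => erefl).

Fact Lmodule_comp_subproof (M N P : Lmodule L) (g : Lmodule_hom N P)
    (f : Lmodule_hom M N) (x : 'I_n.-1 -> L) (m : M) :
  (g \o f) (act x m) = act x ((g \o f) m).
Proof. by rewrite /= !lmod_hom_act. Qed.

Definition Lmodule_comp (M N P : Lmodule L) (g : Lmodule_hom N P)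
    (f : Lmodule_hom M N) : Lmodule_hom M P :=
  @LModuleHom K n L M P (g \o f) (Lmodule_comp_subproof g f).

Fact Lmodule_comp_idl M N (f : Lmodule_hom M N) :
  Lmodule_comp (Lmodule_id N) f = f.
Proof. exact: Lmodule_hom_ext. Qed.
Fact Lmodule_comp_idr M N (f : Lmodule_hom M N) :
  Lmodule_comp f (Lmodule_id M) = f.
Proof. exact: Lmodule_hom_ext. Qed.
Fact Lmodule_compA M N P Q (h : Lmodule_hom P Q) (g : Lmodule_hom N P)
    (f : Lmodule_hom M N) :
  Lmodule_comp h (Lmodule_comp g f) = Lmodule_comp (Lmodule_comp h g) f.
Proof. exact: Lmodule_hom_ext. Qed.

Definition Lmodule_cat : category :=
  @Category (Lmodule L) (@Lmodule_hom K n L) Lmodule_id Lmodule_comp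
    Lmodule_comp_idl Lmodule_comp_idr Lmodule_compA.
End LmoduleCategory.

(* The relations defining U(L), for w x = x_1 /\ ... /\ x_{n-1} in T. Indices
   start at 0, so the sign (-1)^(n-i) becomes (-1)^(n-1-i). *)
Inductive assoc_rel (K : comNzRingType) (n : nat) (L : nLie K n) (T : algebra K)
    (w : ('I_n.-1 -> L) -> T) : T -> Prop :=
| AssocCommutator (x y : 'I_n.-1 -> L) :
    assoc_rel w (w x * w y - w y * w x
                 - \sum_(i < n.-1) w (upd y i (bracket (rcons_fam x (y i)))))
| AssocBracket (x : 'I_n -> L) (y : 'I_n.-1.-1 -> L) :
    assoc_rel w (w (cons_fam (bracket x) y)
                 - \sum_(i < n) (-1) ^+ (n.-1 - i)
                     * (w (x \o lift i) * w (cons_fam (x i) y))).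

Fact assoc_rel_map (K : comNzRingType) (n : nat) (L L' : nLie K n)
    (f : nLie_hom L L') (T T' B : algebra K)
    (w : ('I_n.-1 -> L) -> T) (w' : ('I_n.-1 -> L') -> T')
    (F : alg_hom T B) (G : alg_hom T' B) :
  (forall x, F (w x) = G (w' (f \o x))) ->
  (forall s, assoc_rel w' s -> G s = 0) -> forall s, assoc_rel w s -> F s = 0.
Proof.
move=> FG G0 _ [x y|x y].
  rewrite -(G0 _ (AssocCommutator w' (f \o x) (f \o y))).
  rewrite !rmorphB !rmorphM !rmorph_sum !FG; congr (_ - _).
  apply: eq_bigr => i _.
  by rewrite FG comp_upd nLie_hom_bracket comp_rcons_fam.
rewrite -(G0 _ (AssocBracket w' (f \o x) (f \o y))).
rewrite !rmorphB !rmorph_sum FG comp_cons_fam nLie_hom_bracket.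
congr (_ - _); apply: eq_bigr => i _.
by rewrite !rmorphM !rmorph_sign !FG comp_cons_fam.
Qed.

Section AssociatedAlgebra.
Variables (K : comNzRingType) (n : nat).

Definition tensor_wedge (L : nLie K n) (x : 'I_n.-1 -> L) :
  tensor_alg (ext_power n.-1 L) := tensor_gen (wedge x).

Definition assoc_alg (L : nLie K n) : algebra K :=
  alg_quot (assoc_rel (@tensor_wedge L)).

Definition assoc_proj (L : nLie K n) :
  alg_hom (tensor_alg (ext_power n.-1 L)) (assoc_alg L) :=
  alg_proj (assoc_rel (@tensor_wedge L)).

Definition assoc_gen (L : nLie K n) (x : 'I_n.-1 -> L) : assoc_alg L :=
  assoc_proj L (tensor_wedge x).

Section Functoriality.
Variables (L L' : nLie K n) (f : nLie_hom L L').

Definition assoc_pre_map (v : ext_power n.-1 L) : assoc_alg L' :=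
  assoc_proj L' (tensor_gen (ext_map n.-1 f v)).

Fact assoc_pre_map_linear a u v :
  assoc_pre_map (a *: u + v)
  = alg_unit (assoc_alg L') a * assoc_pre_map u + assoc_pre_map v.
Proof.
rewrite /assoc_pre_map; move: (assoc_proj L') => p.
by rewrite linearP tensor_gen_linear rmorphD rmorphM alg_hom_unit.
Qed.

Definition assoc_tensor_map :
  alg_hom (tensor_alg (ext_power n.-1 L)) (assoc_alg L') :=
  tensor_lift assoc_pre_map_linear.

Fact assoc_tensor_mapE x :
  assoc_tensor_map (tensor_wedge x) = assoc_gen (f \o x).
Proof. by rewrite [LHS]tensor_liftE /assoc_pre_map ext_mapE. Qed.

Fact assoc_map_subproof s :
  assoc_rel (@tensor_wedge L) s -> assoc_tensor_map s = 0.
Proof.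
apply: (@assoc_rel_map K n L L' f _ _ _ _ (@tensor_wedge L') _ (assoc_proj L')).
  exact: assoc_tensor_mapE.
exact: alg_proj_gen.
Qed.

Definition assoc_map : alg_hom (assoc_alg L) (assoc_alg L') :=
  alg_lift assoc_map_subproof.

Lemma assoc_mapE x : assoc_map (assoc_gen x) = assoc_gen (f \o x).
Proof. by rewrite [LHS]alg_liftE assoc_tensor_mapE. Qed.
End Functoriality.

Lemma assoc_alg_ext (L : nLie K n) (B : algebra K)
    (f g : alg_hom (assoc_alg L) B) :
  (forall x, f (assoc_gen x) = g (assoc_gen x)) -> f = g.
Proof.
move=> fg; apply: alg_quot_ext => t.
suff: alg_comp f (assoc_proj L) = alg_comp g (assoc_proj L).
  exact: (congr1 (fun h : alg_hom _ _ => h t)).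
have {}fg x : alg_comp f (assoc_proj L) (tensor_wedge x)
            = alg_comp g (assoc_proj L) (tensor_wedge x) by exact: fg.
apply: tensor_alg_ext; move: (alg_comp f _) (alg_comp g _) fg => {}f {}g fg.
elim/ext_power_ind => [|a x v IH].
  have e : tensor_gen (0 : ext_power n.-1 L) = 0.
    have := tensor_gen_linear (-1) (0 : ext_power n.-1 L) 0.
    by rewrite scaler0 addr0 rmorphN1 mulN1r addNr.
  by rewrite e !rmorph0.
rewrite tensor_gen_linear !rmorphD !rmorphM !alg_hom_unit IH.
by congr (_ * _ + _); apply: fg.
Qed.

Fact assoc_map_id (L : nLie K n) : assoc_map (nLie_id L) = alg_id (assoc_alg L).
Proof. by apply: assoc_alg_ext => x; rewrite assoc_mapE. Qed.

Fact assoc_map_comp (L1 L2 L3 : nLie K n) (g : nLie_hom L2 L3)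
    (f : nLie_hom L1 L2) :
  assoc_map (nLie_comp g f) = alg_comp (assoc_map g) (assoc_map f).
Proof.
apply: assoc_alg_ext => x; rewrite assoc_mapE.
rewrite -[RHS]/(assoc_map g (assoc_map f (assoc_gen x))).
by rewrite (assoc_mapE f) (assoc_mapE g).
Qed.

Definition assoc_functor : functor (nLie_cat K n) (alg_cat K) :=
  @Functor (nLie_cat K n) (alg_cat K) assoc_alg assoc_map
    assoc_map_id assoc_map_comp.
End AssociatedAlgebra.

(* Main.v *)
From HB Require Import structures.
From mathcomp Require Import all_boot all_fingroup all_algebra.
From mathcomp Require Import boolp classical_sets.
From mathcomp Require Import finmap monalg.
Require Import Defs.

(* Suppose n > 2, F is left adjoint to G, and L-modules are F(L)-modules for all L.
   The abelian algebra K^(n-1) is a coproduct of n - 1 copies of K, and its category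
   of modules has the generator K[t], with commutative endomorphism ring. Hence
   B = F(K^(n-1)) is Morita equivalent to a commutative ring, so that its two-sided
   ideals commute; moreover any two maps A -> Y from A = F(K) factor through B.
   Mapping B to triangular matrices shows, for the augmentation ideal A+ of A, that
   f(A+) g(A+) = 0 for all maps f, g : A -> Y. As F(L) is generated by images of A,
   it is commutative for every L.
   Over a commutative ring, extensions between non-isomorphic simple modules split.
   This fails for modules over L = K^n with bracket det(x).e_0: take e_0 (x) S inside
   (K e_0 + K e_1) (x) S, for a simple K-module S.
   For U itself, n > 2 is excluded because U(K) = K while U(K^(n-1)) is not K, and
   for n = 2 the right adjoint is the commutator Lie algebra. *)

Set Implicit Arguments.
Unset Strict Implicit.
Unset Printing Implicit Defensive.

Import GRing.Theory.
Local Open Scope ring_scope.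

(** * Multilinear families and determinants *)

(** The equivalences between L-modules and F(L)-modules are abstract: they need not respect the
    underlying K-modules and are unrelated for different L. So F(L) cannot be compared with U(L);
    each equivalence determines it only up to Morita equivalence, and only properties expressed by
    morphisms can be transported. Morita theory alone never yields commutativity, as matrix rings
    show; the adjunction has to supply it. Triangular matrices are the test objects because their
    ideals do not commute: a corner entry times a diagonal entry can vanish in one order and not in
    the other. The condition n > 2 enters through the coproduct. An alternating bracket of n
    arguments vanishes on the span of n - 1 elements, so any n - 1 elements of an n-Lie algebra are
    the images of the basis of the abelian algebra K^(n-1). Two free places are needed for two
    unrelated maps f and g, and n = 2 leaves only one. *)

Section Families.
Variable T : Type.

Lemma upd_id m (x : 'I_m -> T) i : upd x i (x i) = x.
Proof. by apply: funext => k; rewrite /upd; case: eqP => [->|]. Qed.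

Lemma upd_eq m (x : 'I_m -> T) i a : upd x i a i = a.
Proof. by rewrite /upd eqxx. Qed.

Lemma upd_neq m (x : 'I_m -> T) i a j : j != i -> upd x i a j = x j.
Proof. by rewrite /upd => /negPf ->. Qed.

Lemma rcons_fam_max m (y : 'I_m -> T) a : rcons_fam (n := m.+1) y a ord_max = a.
Proof. by rewrite /rcons_fam nth_rcons size_codom card_ord ltnn eqxx. Qed.

Lemma rcons_fam_lift m (y : 'I_m -> T) a j :
  rcons_fam (n := m.+1) y a (lift ord_max j) = y j.
Proof.
rewrite /rcons_fam nth_rcons size_codom card_ord lift_max ltn_ord.
by rewrite codomE (nth_map j) ?size_enum_ord // nth_ord_enum.
Qed.

Lemma cons_fam0 m (y : 'I_m -> T) a : cons_fam (n := m.+1) a y ord0 = a.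
Proof. by []. Qed.

Lemma cons_fam_lift m (y : 'I_m -> T) a j :
  cons_fam (n := m.+1) a y (lift ord0 j) = y j.
Proof.
by rewrite /cons_fam lift0 /= codomE (nth_map j) ?size_enum_ord // nth_ord_enum.
Qed.

Lemma rcons_fam_upd m (y : 'I_m -> T) a i b :
  rcons_fam (n := m.+1) (upd y i b) a =
  upd (rcons_fam (n := m.+1) y a) (lift ord_max i) b.
Proof.
apply: funext => k; case: (unliftP ord_max k) => [j|] ->.
  rewrite rcons_fam_lift /upd (inj_eq lift_inj); case: eqP => // _.
  by rewrite rcons_fam_lift.
by rewrite rcons_fam_max upd_neq ?neq_lift // rcons_fam_max.
Qed.

Lemma rcons_fam_updmax m (y : 'I_m -> T) a b :
  upd (rcons_fam (n := m.+1) y a) ord_max b = rcons_fam (n := m.+1) y b.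
Proof.
apply: funext => k; case: (unliftP ord_max k) => [j|] ->.
  by rewrite upd_neq 1?eq_sym ?neq_lift // !rcons_fam_lift.
by rewrite upd_eq rcons_fam_max.
Qed.

Lemma cons_fam_upd0 m (y : 'I_m -> T) a b :
  upd (cons_fam (n := m.+1) a y) ord0 b = cons_fam (n := m.+1) b y.
Proof.
apply: funext => k; case: (unliftP ord0 k) => [j|] ->.
  by rewrite upd_neq 1?eq_sym ?neq_lift // !cons_fam_lift.
by rewrite upd_eq.
Qed.
End Families.

Section MultilinearTheory.
Variables (K : pzRingType) (V W : lmodType K) (m : nat) (f : ('I_m -> V) -> W).
Hypothesis fM : multilinear f.

Lemma multilinear_upd0 x i : f (upd x i 0) = 0.
Proof.
by have := fM x i (-1) 0 0; rewrite scaler0 addr0 scaleN1r addNr.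
Qed.

Lemma multilinear_updZ x i a u : f (upd x i (a *: u)) = a *: f (upd x i u).
Proof. by rewrite -[a *: u]addr0 fM multilinear_upd0 addr0. Qed.

Lemma multilinear_updD x i u v :
  f (upd x i (u + v)) = f (upd x i u) + f (upd x i v).
Proof. by rewrite -[u]scale1r fM !scale1r. Qed.

Lemma multilinear_sum (I : Type) (r : seq I) x i (a : I -> K) (c : I -> V) :
  f (upd x i (\sum_(j <- r) a j *: c j)) =
  \sum_(j <- r) a j *: f (upd x i (c j)).
Proof.
elim: r => [|j r IH]; first by rewrite !big_nil multilinear_upd0.
by rewrite !big_cons fM IH.
Qed.

Lemma multilinear_eq0 x i : x i = 0 -> f x = 0.
Proof. by move=> xi; rewrite -(upd_id x i) xi multilinear_upd0. Qed.

Hypothesis fA : alternating f.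

Lemma alternating_tperm x i j : i != j -> f (x \o tperm i j) = - f x.
Proof.
move=> ij; pose h a b := f (upd (upd x i a) j b).
have updC a b : upd (upd x i a) j b = upd (upd x j b) i a.
  apply: funext => k; rewrite /upd; case: (k =P j) => [->|//].
  by rewrite eq_sym (negPf ij).
have h0 a : h a a = 0.
  by apply: (fA ij); rewrite upd_eq upd_neq // upd_eq.
have hDr a b c : h a (b + c) = h a b + h a c by exact: multilinear_updD.
have hDl a b c : h (a + b) c = h a c + h b c.
  by rewrite /h !updC multilinear_updD.
have := h0 (x i + x j); rewrite hDl !hDr !h0 add0r addr0 => /eqP.
have -> : h (x i) (x j) = f x.
  by rewrite /h upd_id; congr f; rewrite upd_id.
rewrite addr_eq0 => /eqP ->; rewrite opprK; congr f; apply: funext => k /=.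
rewrite /upd; case: (k =P j) => [->|/eqP kj]; first by rewrite tpermR.
case: (k =P i) => [->|/eqP ki]; first by rewrite tpermL.
by rewrite tpermD // eq_sym.
Qed.

Lemma alternating_perm x (s : 'S_m) : f (x \o s) = (-1) ^+ s *: f x.
Proof.
have [ts -> ] := prod_tpermP s; elim: ts x => [|[i j] ts IH] x /=.
  move=> _; rewrite big_nil odd_perm1 expr0 scale1r.
  by congr f; apply: funext => k /=; rewrite perm1.
case/andP=> ij /IH {}IH; rewrite /= in ij.
rewrite big_cons odd_mul_tperm ij signr_addb expr1 mulN1r scaleNr -IH.
rewrite -(alternating_tperm _ ij); congr f.
by apply: funext => k /=; rewrite permM.
Qed.
End MultilinearTheory.

Lemma multilinear_ext (K : pzRingType) (V W : lmodType K) (m p : nat)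
    (f g : ('I_m -> V) -> W) (c : 'I_p -> V) :
  multilinear f -> multilinear g ->
  (forall v, exists a : 'I_p -> K, v = \sum_j a j *: c j) ->
  (forall phi : 'I_m -> 'I_p, f (c \o phi) = g (c \o phi)) -> f =1 g.
Proof.
move=> fM gM cV fg x.
(* [k] bounds the leading arguments that may still be arbitrary; expanding the last of them in the
   [c j] lowers it. *)
suff fgk k y : (forall i : 'I_m, (k <= i)%N -> exists j, y i = c j) -> f y = g y.
  by apply: (fgk m) => i; rewrite leqNgt ltn_ord.
elim: k y => [|k IH] y yc.
  have /choice[phi yphi] : forall i : 'I_m, exists j, y i = c j by move=> i; apply: yc.
  by rewrite (_ : y = c \o phi) //; apply: funext.
have [km|mk] := ltnP k m; last first.
  by apply: IH => i ki; have := leq_trans mk ki; rewrite leqNgt ltn_ord.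
have [a ya] := cV (y (Ordinal km)).
rewrite -(upd_id y (Ordinal km)) ya !multilinear_sum //.
apply: eq_bigr => j _; congr (_ *: _); apply: IH => i ki.
rewrite /upd; case: eqP => [_|/eqP iNk]; first by exists j.
by apply: yc; rewrite ltn_neqAle ki andbT eq_sym.
Qed.

(** Expansion leaves families of m arguments with only p < m possible values, so two arguments
    agree. This makes n-Lie brackets vanish on the span of fewer than n elements, and gives U(K) = K
    for n > 2. *)
Lemma alternating_eq0 (K : pzRingType) (V W : lmodType K) (m p : nat)
    (f : ('I_m -> V) -> W) (c : 'I_p -> V) (a : 'I_m -> 'I_p -> K) :
  multilinear f -> alternating f -> (p < m)%N ->
  f (fun i => \sum_j a i j *: c j) = 0.
Proof.
(* The [c j] need not span V, so the expansion takes place on the rows of coefficients. *)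
move=> fM fA pm; pose s (v : 'rV[K]_p) := \sum_j v 0 j *: c j.
have sP k u v : s (k *: u + v) = k *: s u + s v.
  rewrite /s scaler_sumr -big_split; apply: eq_bigr => j _.
  by rewrite !mxE scalerDl scalerA.
have gE : (fun x : 'I_m -> 'rV_p => f (s \o x)) =1 (fun=> 0).
  apply: (multilinear_ext (c := fun j => delta_mx 0 j)).
  - by move=> x i k u v; rewrite !comp_upd sP fM.
  - by move=> x i k u v; rewrite scaler0 addr0.
  - by move=> v; exists (v 0); rewrite [v in LHS]row_sum_delta.
  move=> phi; have /injectivePn[i [j ij phiij]] : ~~ injectiveb phi.
    apply: contraL pm => /injectiveP /leq_card.
    by rewrite !card_ord -leqNgt.
  by apply: (fA _ i j ij); rewrite /= phiij.
rewrite -[RHS](gE (fun i => \row_j a i j)); congr f; apply: funext => i.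
by apply: eq_bigr => j _; rewrite mxE.
Qed.

Section Determinant.
Variables (C : comNzRingType) (m : nat).

Definition det_rows (x : 'I_m -> 'rV[C]_m) : C^o := \det (\matrix_i x i).

Lemma matrix_upd (x : 'I_m -> 'rV[C]_m) i u :
  [/\ row i (\matrix_k upd x i u k) = u
    & row' i (\matrix_k upd x i u k) = row' i (\matrix_k x k)].
Proof.
split; first by rewrite rowK upd_eq.
by apply/matrixP => k l; rewrite !mxE upd_neq // eq_sym neq_lift.
Qed.

Lemma det_rows_multilinear : multilinear det_rows.
Proof.
move=> x i a u v.
have [ru r'u] := matrix_upd x i u; have [rv r'v] := matrix_upd x i v.
have [rw r'w] := matrix_upd x i (a *: u + v).
rewrite -[RHS]/(a * det_rows (upd x i u) + det_rows (upd x i v)).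
rewrite -[X in _ = _ + X]mul1r.
apply: (@determinant_multilinear C m (\matrix_k upd x i (a *: u + v) k)
  (\matrix_k upd x i u k) (\matrix_k upd x i v k) i a 1).
- by rewrite ru rv rw scale1r.
- by rewrite r'u r'w.
- by rewrite r'v r'w.
Qed.

Lemma det_rows_alternating : alternating det_rows.
Proof.
move=> x i j ij xij; apply: (determinant_alternate ij) => k.
by rewrite !mxE xij.
Qed.

Lemma det_rows_cramer (x : 'I_m -> 'rV[C]_m) v :
  \sum_i det_rows (upd x i v) *: x i = det_rows x *: v.
Proof.
set X := \matrix_i x i.
have -> : det_rows x *: v = v *m \adj X *m X.
  by rewrite -mulmxA mul_adj_mx mul_mx_scalar.
rewrite mulmx_sum_row; apply: eq_bigr => i _; rewrite rowK; congr (_ *: _).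
rewrite /det_rows (expand_det_row _ i) mxE; apply: eq_bigr => j _.
rewrite !mxE upd_eq; congr (_ * _); rewrite /cofactor; congr (_ * \det _).
by apply/matrixP => k l; rewrite !mxE upd_neq // eq_sym neq_lift.
Qed.

Lemma alternating_det (W : lmodType C) (f : ('I_m -> 'rV[C]_m) -> W) x :
  multilinear f -> alternating f ->
  f x = det_rows x *: f (fun i => delta_mx 0 i).
Proof.
move=> fM fA; pose e (i : 'I_m) : 'rV[C]_m := delta_mx 0 i.
suff: f =1 (fun x => det_rows x *: f e) by apply.
apply: (multilinear_ext (c := e)) => //.
- by move=> y i a u v; rewrite det_rows_multilinear scalerDl scalerA.
- by move=> v; exists (v 0); rewrite [v in LHS]row_sum_delta.
move=> phi; have [/injectiveP phi_inj|/injectivePn[i [j ij phiij]]] :=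
  boolP (injectiveb phi); last first.
  rewrite (fA _ i j ij) /= ?phiij // (det_rows_alternating ij) /= ?phiij //.
  by rewrite scale0r.
have -> : e \o phi = e \o perm phi_inj by apply: funext => i /=; rewrite permE.
rewrite (alternating_perm fM fA).
rewrite (alternating_perm det_rows_multilinear det_rows_alternating).
have -> : det_rows e = 1.
  rewrite /det_rows (_ : \matrix_i e i = 1%:M) ?det1 //.
  by apply/matrixP => i j; rewrite !mxE eqxx eq_sym.
by rewrite -[_ *: 1]/(_ * 1) mulr1.
Qed.
End Determinant.

(** * Rings whose modules have a generator with commutative endomorphisms *)

Definition commutative_generator (C : category) (G : C) : Prop :=
  (forall (X Y : C) (f g : hom X Y),
     (forall h : hom G X, comp f h = comp g h) -> f = g) /\
  (forall a b : hom G G, comp a b = comp b a).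

Section RankOne.
Variables (B : pzRingType) (G : lmodType B) (h : {linear G -> B^o}) (u : G).

(** The image of (h, u) under the Morita pairing of Hom(G, B) and G with values in End(G). *)
Definition rank_one (g : G) : G := (h g : B) *: u.

Fact rank_one_linear : linear rank_one.
Proof. by move=> a x y; rewrite /rank_one linearP scalerDl scalerA. Qed.
HB.instance Definition _ :=
  GRing.isLinear.Build B G G *:%R rank_one rank_one_linear.
End RankOne.

Section GeneratorRing.
Variables (B : pzRingType) (G : lmodType B).
Hypothesis Ggen : @commutative_generator (mod_cat B) G.

Let trace (x : B^o) : Prop := exists (h : {linear G -> B^o}) g, x = h g.

(** The projection of B onto its quotient by the trace ideal vanishes after every map from G. As G
    is a generator, the projection is zero and the trace ideal contains 1. *)
Lemma generator_trace1 :
  exists s : seq ({linear G -> B^o} * G), 1 = \sum_(p <- s) p.1 p.2 :> B.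
Proof.
have pr0 : (mproj trace : {linear B^o -> module_quot trace}) = \0.
  apply: (Ggen.1 B^o (module_quot trace)) => h; apply: linear_ext => g.
  by rewrite /=; apply: mproj_gen; exists h, g.
have : span_of trace 1.
  rewrite -[1]subr0; apply/mproj_eq; rewrite raddf0.
  by have := congr1 (fun f : {linear B^o -> module_quot trace} => f 1) pr0.
elim => [x [h [g ->]]||a u v _ [su ->] _ [sv ->]].
- by exists [:: (h, g)]; rewrite big_seq1.
- by exists [::]; rewrite big_nil.
exists ([seq (p.1, a *: p.2) | p <- su] ++ sv).
rewrite big_cat big_map scaler_sumr; congr (_ + _).
by apply: eq_bigr => p _; rewrite linearZ.
Qed.

(* Morally B is Morita equivalent to the commutative ring End(G), over which
   two-sided ideals commute: BbB.Bb'B = 0 forces Bb'B.BbB = 0, here in the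
   quotient ring B / ker psi. *)
Lemma generator_swap (D : pzRingType) (psi : {rmorphism B -> D}) (b b' : B) :
  (forall x, psi (b * x * b') = 0) -> psi (b' * b) = 0.
Proof.
move=> bxb'; have [s s1] := generator_trace1.
(* The rank-one endomorphisms given by (h, x u) and (h', y u') commute; both composites are
   evaluated at g and h'' is applied. *)
have swap (h h' h'' : {linear G -> B^o}) x y u u' g :
    (h' g : B) * y * (h u' : B) * x * (h'' u : B) =
    (h g : B) * x * (h' u : B) * y * (h'' u' : B).
  have := Ggen.2 (rank_one h (x *: u) : {linear G -> G})
                 (rank_one h' (y *: u') : {linear G -> G}).
  move=> /(congr1 (fun f : {linear G -> G} => h'' (f g))) /=.
  rewrite /rank_one !linearZ /= => e.
  have : (h' g : B) * (y * (h u' : B)) * (x * (h'' u : B)) =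
         (h g : B) * (x * (h' u : B)) * (y * (h'' u' : B)) by exact: e.
  by rewrite !mulrA.
(* With 1 = sum of h(g) inserted around b' and b, every term is an instance of [swap] with y = b'
   and x = b, which produces a factor b z b'. *)
have -> : b' * b = \sum_(p <- s) \sum_(q <- s) \sum_(r <- s)
    (p.1 p.2 : B) * b' * (q.1 q.2 : B) * b * (r.1 r.2 : B).
  rewrite -[LHS]mul1r {1}s1 mulr_suml; apply: eq_bigr => p _.
  rewrite -[X in X * b]mulr1 {1}s1 mulr_sumr mulr_suml mulr_sumr.
  apply: eq_bigr => q _; rewrite -[LHS]mulr1 {1}s1 mulr_sumr.
  by apply: eq_bigr => r _; rewrite !mulrA.
rewrite !rmorph_sum big1 // => p _; rewrite rmorph_sum big1 // => q _.
rewrite rmorph_sum big1 // => r _.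
rewrite swap -(mulrA (q.1 p.2 : B)) -(mulrA (q.1 p.2 : B)).
by rewrite rmorphM [X in X * _]rmorphM bxb' mulr0 mul0r.
Qed.
End GeneratorRing.

(* Triples (t, m, k) stand for the triangular matrices [[t, m], [0, k]]. *)
Section TriangularAlgebra.
Variables (K : comNzRingType) (Y : algebra K).

Definition triangular : Type := (Y * Y * K)%type.
HB.instance Definition _ := GRing.Zmodule.on triangular.

Definition tri_mul (p q : triangular) : triangular :=
  (p.1.1 * q.1.1, p.1.1 * q.1.2 + p.1.2 * alg_unit Y q.2, p.2 * q.2).

Fact tri_mulA : associative tri_mul.
Proof.
move=> [[t m] k] [[t' m'] k'] [[t'' m''] k'']; rewrite /tri_mul /=.
by rewrite !mulrA mulrDr mulrDl rmorphM !mulrA addrA.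
Qed.
Fact tri_mul1l : left_id (1, 0, 1 : K) tri_mul.
Proof. by move=> [[t m] k]; rewrite /tri_mul /= !mul1r mul0r addr0. Qed.
Fact tri_mul1r : right_id (1, 0, 1 : K) tri_mul.
Proof. by move=> [[t m] k]; rewrite /tri_mul /= rmorph1 !mulr1 mulr0 add0r. Qed.
Fact tri_mulDl : left_distributive tri_mul +%R.
Proof.
move=> [[t m] k] [[t' m'] k'] [[t'' m''] k'']; rewrite /tri_mul /=.
by congr (_, _, _); rewrite /= !mulrDl // addrACA.
Qed.
Fact tri_mulDr : right_distributive tri_mul +%R.
Proof.
move=> [[t m] k] [[t' m'] k'] [[t'' m''] k'']; rewrite /tri_mul /=.
by congr (_, _, _); rewrite /= ?rmorphD !mulrDr // addrACA.
Qed.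
HB.instance Definition _ := GRing.Zmodule_isPzRing.Build triangular
  tri_mulA tri_mul1l tri_mul1r tri_mulDl tri_mulDr.

Definition tri_unit (k : K) : triangular := (alg_unit Y k, 0, k).

Fact tri_unit_zmod_morphism : zmod_morphism tri_unit.
Proof. by move=> a b; congr (_, _, _); rewrite ?rmorphB ?subr0. Qed.
HB.instance Definition _ :=
  GRing.isZmodMorphism.Build K triangular tri_unit tri_unit_zmod_morphism.
Fact tri_unit_monoid_morphism : monoid_morphism tri_unit.
Proof.
split=> [|a b]; first by rewrite /tri_unit rmorph1.
by congr (_, _, _); rewrite /= ?rmorphM // mulr0 mul0r addr0.
Qed.
HB.instance Definition _ :=
  GRing.isMonoidMorphism.Build K triangular tri_unit tri_unit_monoid_morphism.

Fact tri_central k (p : triangular) : tri_unit k * p = p * tri_unit k.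
Proof.
case: p => [[t m] l]; congr (_, _, _); rewrite /= ?alg_central 1?mulrC //.
by rewrite mul0r mulr0 addr0 add0r.
Qed.

Definition tri_alg : algebra K := @Algebra K triangular tri_unit tri_central.
End TriangularAlgebra.

Definition base_alg (K : comNzRingType) : algebra K :=
  @Algebra K K idfun (fun k a => mulrC k a).

(** * Augmentation ideals and triangular matrices *)

Section Augmentation.
Variables (K : comNzRingType) (A : algebra K) (eps : alg_hom A (base_alg K)).

Fact eps_unit k : eps (alg_unit A k) = k.
Proof. exact: alg_hom_unit. Qed.

Definition aug_hom (Y : algebra K) : alg_hom A Y :=
  @AlgHom K A Y (alg_unit Y \o eps)
    (fun k => congr1 (alg_unit Y) (eps_unit k)).

Section TriangularHom.
Variables (Y : algebra K) (f : alg_hom A Y) (d : A -> Y).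
Hypotheses (dB : zmod_morphism d) (dU : forall k, d (alg_unit A k) = 0).
Hypothesis dM : forall a b, d (a * b) = f a * d b + d a * aug_hom Y b.

(** The matrix [[f a, d a], [0, eps a]] is multiplicative in a precisely because d is a derivation
    from f to the augmentation, which is [dM]. *)
Definition tri_hom_fun (a : A) : tri_alg Y := (f a, d a, eps a).

Fact tri_hom_zmod_morphism : zmod_morphism tri_hom_fun.
Proof. by move=> a b; congr (_, _, _); rewrite ?rmorphB ?dB. Qed.
HB.instance Definition _ :=
  GRing.isZmodMorphism.Build A (tri_alg Y) tri_hom_fun tri_hom_zmod_morphism.

Fact tri_hom_monoid_morphism : monoid_morphism tri_hom_fun.
Proof.
split=> [|a b]; last by congr (_, _, _); rewrite ?rmorphM ?dM.
by congr (_, _, _); rewrite ?rmorph1 // -(rmorph1 (alg_unit A)) dU.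
Qed.
HB.instance Definition _ :=
  GRing.isMonoidMorphism.Build A (tri_alg Y) tri_hom_fun tri_hom_monoid_morphism.

Fact tri_hom_unit k : tri_hom_fun (alg_unit A k) = alg_unit (tri_alg Y) k.
Proof. by rewrite /tri_hom_fun alg_hom_unit dU eps_unit. Qed.

Definition tri_hom : alg_hom A (tri_alg Y) :=
  @AlgHom K A (tri_alg Y) tri_hom_fun tri_hom_unit.
End TriangularHom.

Variables (B : algebra K) (i1 i2 : alg_hom A B).
Hypothesis B_swap : forall (D : pzRingType) (psi : {rmorphism B -> D}) (b b' : B),
  (forall x, psi (b * x * b') = 0) -> psi (b' * b) = 0.
Hypothesis B_gen : forall (Y : algebra K) (f g : alg_hom A Y),
  exists psi : alg_hom B Y,
    (forall a, psi (i1 a) = f a) /\ (forall a, psi (i2 a) = g a).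

(** The zeros on the diagonals give [psi (b * y * b') = 0] for all y, while t m is the corner of
    [psi (b' * b)]. *)
Lemma triangular_swap (Y : algebra K) (psi : alg_hom B (tri_alg Y)) b b' t m x :
  psi b = (0, m, 0) -> psi b' = (t, x, 0) -> t * m = 0.
Proof.
move=> pb pb'; suff: psi (b' * b) = 0.
  by rewrite rmorphM pb pb' => -[_ <- _]; rewrite /= rmorph0 mulr0 addr0.
apply: B_swap => y; rewrite !rmorphM pb pb'; case: (psi y) => [[t' m'] k'].
by congr (_, _, _); rewrite /= ?rmorph0 ?mul0r ?mulr0 ?addr0.
Qed.

(** The map d = id - eps is a derivation from the identity to the augmentation. The homomorphisms
    [[x, 0], [0, eps x]] and [[x, d x], [0, eps x]] factor together through B; at b they differ by
    the corner entry b, and the first sends a to a diagonal entry. *)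
Lemma augmentation_square a b : eps a = 0 -> eps b = 0 -> a * b = 0.
Proof.
move=> a0 b0; pose d (x : A) := x - aug_hom A x.
have dB : zmod_morphism d.
  by move=> x y; rewrite /d !rmorphB opprD addrACA -opprD.
have dU k : d (alg_unit A k) = 0 by rewrite /d alg_hom_unit subrr.
have dM x y : d (x * y) = alg_id A x * d y + d x * aug_hom A y.
  by rewrite /d /= rmorphM mulrBr mulrBl addrA subrK rmorphM.
have zB : zmod_morphism (fun _ : A => 0 : A) by move=> x y; rewrite subr0.
have zM x y : 0 = alg_id A x * 0 + 0 * aug_hom A y by rewrite mulr0 mul0r addr0.
have [psi [psi1 psi2]] := B_gen (tri_hom zB (fun=> erefl) zM) (tri_hom dB dU dM).
apply: (@triangular_swap A psi (i2 b - i1 b) (i1 a) _ _ 0).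
  rewrite rmorphB psi1 psi2; congr (_, _, _); rewrite /= ?subrr //.
  by rewrite /d /= b0 rmorph0 !subr0.
by rewrite psi1 /= /tri_hom_fun a0.
Qed.

(** Now that the augmentation ideal has square zero, g - eps is a derivation from the augmentation
    to itself. So g(b) can stand alone in the corner of one matrix, and f(a) alone on the diagonal
    of the other. *)
Lemma augmentation_orthogonal (Y : algebra K) (f g : alg_hom A Y) a b :
  eps a = 0 -> eps b = 0 -> f a * g b = 0.
Proof.
move=> a0 b0; pose d (x : A) := g x - aug_hom Y x.
have dB : zmod_morphism d.
  by move=> x y; rewrite /d !rmorphB opprD addrACA -opprD.
have dU k : d (alg_unit A k) = 0 by rewrite /d !alg_hom_unit subrr.
have dM x y : d (x * y) = aug_hom Y x * d y + d x * aug_hom Y y.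
  (* The rule is g applied to (x - eps x)(y - eps y) = 0, expanded. *)
  have := @augmentation_square (x - aug_hom A x) (y - aug_hom A y).
  rewrite !rmorphB /= !eps_unit !subrr => /(_ erefl erefl) /(congr1 g).
  rewrite rmorph0 rmorphM !rmorphB /= !alg_hom_unit => e.
  rewrite -[RHS]addr0 -e -addrA -mulrDr addrCA subrr addr0 mulrBr mulrBl.
  by rewrite addrC addrA subrK /d !rmorphM.
have zB : zmod_morphism (fun _ : A => 0 : Y) by move=> x y; rewrite subr0.
have zM x y : 0 = f x * 0 + 0 * aug_hom Y y by rewrite mulr0 mul0r addr0.
have [psi [psi1 psi2]] := B_gen (tri_hom zB (fun=> erefl) zM) (tri_hom dB dU dM).
apply: (@triangular_swap Y psi (i2 b) (i1 a) _ _ 0).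
  rewrite psi2 /= /tri_hom_fun; congr (_, _, _); rewrite //= ?b0 ?rmorph0 //.
  by rewrite /d /= b0 rmorph0 !subr0.
by rewrite psi1 /= /tri_hom_fun a0.
Qed.
End Augmentation.

(** * Left adjoints defined on n-Lie algebras *)

Section AbelianNLie.
Variables (K : comNzRingType) (n : nat).

Fact abelian_nLie (V : lmodType K) : is_nLie (fun _ : 'I_n -> V => 0 : V).
Proof.
split=> [x i a u v|x i j _ _|x y]; rewrite ?scaler0 ?addr0 //.
by rewrite big1.
Qed.

Definition abelian (V : lmodType K) : nLie K n := NLie (abelian_nLie V).

Section Combination.
Variables (p : nat) (pn : (p < n)%N) (H : nLie K n) (c : 'I_p -> H).

Definition combination (x : 'rV[K]_p) : H := \sum_j x 0 j *: c j.

Fact combination_linear : linear combination.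
Proof.
move=> a u v; rewrite /combination scaler_sumr -big_split.
by apply: eq_bigr => j _; rewrite !mxE scalerDl scalerA.
Qed.
HB.instance Definition _ :=
  GRing.isLinear.Build K 'rV[K]_p H *:%R combination combination_linear.

(** All brackets of combinations of p < n elements vanish, which is why the p elements may be chosen
    freely in H. *)
Fact combination_bracket (x : 'I_n -> abelian 'rV[K]_p) :
  combination (bracket x) = bracket (combination \o x).
Proof.
have [HM HA _] := bracket_nLie H.
by rewrite (alternating_eq0 c (fun i => x i 0) HM HA pn) raddf0.
Qed.

Definition combination_hom : nLie_hom (abelian 'rV[K]_p) H :=
  NLieHom combination_bracket.

Lemma combination_delta j : combination_hom (delta_mx 0 j) = c j.
Proof.
rewrite /= /combination (bigD1 j) //= big1 ?addr0 => [|i ij].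
  by rewrite mxE !eqxx scale1r.
by rewrite mxE (negPf ij) andbF scale0r.
Qed.
End Combination.

Lemma abelian_hom_ext p (H : nLie K n) (f g : nLie_hom (abelian 'rV[K]_p) H) :
  (forall j, f (delta_mx 0 j) = g (delta_mx 0 j)) -> f = g.
Proof.
move=> fg; apply: nLie_hom_ext => x; rewrite [x]row_sum_delta !linear_sum.
by apply: eq_bigr => j _; rewrite !linearZ fg.
Qed.
End AbelianNLie.

(* The maps R -> M_2(R), s |-> s and s |-> u s u^-1 for u = [[1, r], [0, 1]], agree
   exactly on the centralizer of r. *)
Section ScalarConjugation.
Variables (K : comNzRingType) (R : algebra K).

Fact matrix2_central k (M : 'M[R]_2) :
  (alg_unit R k)%:M * M = M * (alg_unit R k)%:M.
Proof.
rewrite -mulmxE mul_scalar_mx; apply/matrixP => i j; rewrite !mxE.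
rewrite (bigD1 j) //= big1 => [|l lj]; rewrite mxE ?(negPf lj) ?mulr0 //.
by rewrite eqxx addr0 alg_central.
Qed.

Definition matrix2_alg : algebra K :=
  @Algebra K 'M[R]_2 (scalar_mx \o alg_unit R) matrix2_central.

Definition scalar_hom : alg_hom R matrix2_alg :=
  @AlgHom K R matrix2_alg (scalar_mx : R -> 'M[R]_2) (fun=> erefl).

Variable r : R.
Let u : 'M[R]_2 := 1 + r *: delta_mx 0 1.
Let v : 'M[R]_2 := 1 - r *: delta_mx 0 1.

Let uv : u * v = 1 /\ v * u = 1.
Proof.
have n0 : (r *: delta_mx 0 1 : 'M[R]_2) * (r *: delta_mx 0 1) = 0.
  apply/matrixP => i j; rewrite !mxE !big_ord_recl !big_ord0 !mxE.
  by rewrite /= ?(andbF, mulr0, mul0r, addr0).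
rewrite /u /v !mulrDl !mulrDr !mul1r !mulr1 !mulrN !mulNr n0 oppr0 !addr0.
by rewrite subrK addrK.
Qed.

Definition conj_scalar (s : R) : matrix2_alg := u * s%:M * v.

Fact conj_scalar_zmod_morphism : zmod_morphism conj_scalar.
Proof. by move=> a b; rewrite /conj_scalar raddfB (mulrBr u) (mulrBl v). Qed.
HB.instance Definition _ := GRing.isZmodMorphism.Build R matrix2_alg conj_scalar
  conj_scalar_zmod_morphism.
Fact conj_scalar_monoid_morphism : monoid_morphism conj_scalar.
Proof.
split=> [|a b]; first by rewrite /conj_scalar mulr1 uv.1.
rewrite /conj_scalar -!mulrA [v * (u * _)]mulrA uv.2 mul1r !mulrA.
by rewrite scalar_mxM mulmxE mulrA.
Qed.
HB.instance Definition _ := GRing.isMonoidMorphism.Build R matrix2_alg conj_scalar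
  conj_scalar_monoid_morphism.

Fact conj_scalar_unit k : conj_scalar (alg_unit R k) = alg_unit matrix2_alg k.
Proof. by rewrite /conj_scalar -matrix2_central -mulrA uv.1 mulr1. Qed.

Definition conj_scalar_hom : alg_hom R matrix2_alg :=
  @AlgHom K R matrix2_alg conj_scalar conj_scalar_unit.

Lemma conj_scalarP s : conj_scalar_hom s = scalar_hom s <-> s * r = r * s.
Proof.
have usE : u * s%:M = s%:M * u <-> s * r = r * s.
  split=> [/matrixP /(_ 0 1)|sr].
    rewrite !mxE !big_ord_recl !big_ord0 !mxE /=.
    by rewrite ?(mulr1n, mulr0n, mulr0, mulr1, mul1r, mul0r, addr0, add0r).
  apply/matrixP => i j; rewrite !mxE !big_ord_recl !big_ord0 !mxE.
  case: i j => [[|[|[]]] //= ?] [[|[|[]]] //= ?];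
  by rewrite ?(mulr1n, mulr0n, mulr0, mulr1, mul1r, mul0r, addr0, add0r).
rewrite -usE; split=> [/(congr1 ( *%R^~ u))|/= e].
  by rewrite /= /conj_scalar -mulrA uv.2 mulr1.
by rewrite /= /conj_scalar e -mulrA uv.1 mulr1.
Qed.
End ScalarConjugation.

(** * Commutativity of the values of a left adjoint *)

Section AdjunctionTheory.
Variables (K : comNzRingType) (m : nat).
Hypothesis m_gt1 : (1 < m)%N.
Variables (F : functor (nLie_cat K m.+1) (alg_cat K)).
Variables (G : functor (alg_cat K) (nLie_cat K m.+1)) (FG : adjoint F G).

Let one : nLie K m.+1 := abelian m.+1 'rV[K]_1.
Let free : nLie K m.+1 := abelian m.+1 'rV[K]_m.
Let A : algebra K := F one.

Let one_lt : (1 < m.+1)%N := leqW m_gt1.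

Let point (L : nLie K m.+1) (x : L) : nLie_hom one L :=
  combination_hom one_lt (fun=> x).

Let at_point (L : nLie K m.+1) (x : L) : alg_hom A (F L) :=
  fmap F (point x : @hom (nLie_cat K m.+1) one L).

(** The maps [at_point x] are jointly epic: the transpose L -> G Y of p is determined by its values,
    and by naturality its value at x is that of the transpose of p after [at_point x] at the basis
    vector of K. *)
Lemma at_point_ext (L : nLie K m.+1) (Y : algebra K) (p q : alg_hom (F L) Y) :
  (forall x a, p (at_point x a) = q (at_point x a)) -> p = q.
Proof.
have [phi [phi_bij phi_nat]] := FG => pq.
apply: (bij_inj (phi_bij L Y)); apply: nLie_hom_ext => x.
have phiE (h : alg_hom (F L) Y) :
    (phi L Y h : nLie_hom L (G Y)) x =
    (phi one Y (alg_comp h (at_point x)) : nLie_hom one (G Y)) (delta_mx 0 0).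
  have := phi_nat L one Y Y (point x) (alg_id Y) h.
  rewrite (fmap_id G) /= => /(congr1 (fun f : nLie_hom one (G Y) => f (delta_mx 0 0))).
  rewrite alg_comp_idl => ->.
  by rewrite /= -[in LHS](combination_delta one_lt (fun=> x) 0).
rewrite !phiE; congr ((phi _ _ _ : nLie_hom _ _) _).
by apply: alg_hom_ext => a; apply: pq.
Qed.

Lemma augmentation_exists : exists eps : alg_hom A (base_alg K), True.
Proof.
have [phi [phi_bij phi_nat]] := FG; have [psi _ _] := phi_bij one (base_alg K).
by exists (psi (combination_hom one_lt (fun=> 0))).
Qed.

Lemma two_points : exists i1 i2 : alg_hom A (F free),
  forall (Y : algebra K) (f g : alg_hom A Y), exists psi : alg_hom (F free) Y,
    (forall a, psi (i1 a) = f a) /\ (forall a, psi (i2 a) = g a).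
Proof.
have [phi [phi_bij phi_nat]] := FG.
pose e j : free := delta_mx 0 j.
exists (at_point (e (Ordinal (ltnW m_gt1)))), (at_point (e (Ordinal m_gt1))) => Y f g.
pose val (h : alg_hom A Y) : G Y :=
  (phi one Y h : nLie_hom one (G Y)) (delta_mx 0 0).
(* Two basis vectors carry f and g, which is where [m_gt1] enters; the remaining ones may go
   anywhere and are given the value for g. *)
pose c (j : 'I_m) := if j == 0%N :> nat then val f else val g.
have [phi' phi'K phiK'] := phi_bij free Y.
pose psi : alg_hom (F free) Y := phi' (combination_hom (leqnn m.+1) c).
have psiE j (h : alg_hom A Y) : c j = val h -> forall a, psi (at_point (e j) a) = h a.
  move=> cj a; suff <- : alg_comp psi (at_point (e j)) = h by [].
  apply: (bij_inj (phi_bij one Y)).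
  have := phi_nat free one Y Y (point (e j)) (alg_id Y) psi.
  rewrite (fmap_id G) /= alg_comp_idl phiK' => ->.
  apply: abelian_hom_ext => i; rewrite (ord1 i) -[RHS]cj.
  rewrite -[RHS](combination_delta (leqnn m.+1) c j) /=; congr combination.
  exact: (combination_delta one_lt (fun=> e j) 0).
by exists psi; split=> a; apply: psiE.
Qed.

Hypothesis free_swap : forall (D : pzRingType)
    (psi : {rmorphism (F free : algebra K) -> D}) (b b' : (F free : algebra K)),
  (forall x, psi (b * x * b') = 0) -> psi (b' * b) = 0.

Lemma adjunction_commutative (L : nLie K m.+1) (r s : (F L : algebra K)) :
  r * s = s * r.
Proof.
have [eps _] := augmentation_exists; have [i1 [i2 B_gen]] := two_points.
have orth := augmentation_orthogonal (eps := eps) free_swap B_gen.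
(* Each argument is a scalar plus an element of the augmentation ideal, and products of the latter
   parts vanish in either order. *)
have comm_points (x y : L) a b :
    at_point x a * at_point y b = at_point y b * at_point x a.
  have split_a (c : A) : exists k c', eps c' = 0 /\ c = alg_unit A k + c'.
    exists (eps c), (c - alg_unit A (eps c)).
    by rewrite rmorphB eps_unit subrr addrC subrK.
  have [k [a' [a0 ->]]] := split_a a; have [l [b' [b0 ->]]] := split_a b.
  rewrite !rmorphD !alg_hom_unit !mulrDl !mulrDr !orth // !addr0.
  rewrite (alg_central k (alg_unit _ l)) (alg_central k) -(alg_central l).
  by rewrite addrAC.
(* Joint epicness is weaker than generation by the images, so commutation with t is encoded as
   equality of two homomorphisms into 2 x 2 matrices. The claim is then used once for each
   factor. *)
have central t : (forall x a, at_point x a * t = t * at_point x a) ->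
    forall u : (F L : algebra K), u * t = t * u.
  move=> t_comm u; apply/conj_scalarP.
  have -> // : conj_scalar_hom t = scalar_hom (F L : algebra K).
  by apply: at_point_ext => x a; apply/conj_scalarP.
apply: (central) => x a; apply/esym; apply: (central).
by move=> y b; apply: comm_points.
Qed.
End AdjunctionTheory.

(** * Equivalences of categories and module categories of commutative rings *)

Definition inverse_homs (C : category) (X Y : C) (u : hom X Y) (v : hom Y X) : Prop :=
  comp u v = idm Y /\ comp v u = idm X.

Section InverseHoms.
Variables (C : category) (X Y : C) (u : hom X Y) (v : hom Y X).
Hypothesis uv : inverse_homs u v.

Lemma inverse_homs_sym : inverse_homs v u.
Proof. by case: uv. Qed.

Lemma comp_cancel_l W (f g : hom W X) : comp u f = comp u g -> f = g.
Proof. by move/(congr1 (comp v)); rewrite !compA uv.2 !comp_idl. Qed.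

Lemma comp_cancel_r W (f g : hom Y W) : comp f u = comp g u -> f = g.
Proof. by move/(congr1 (comp^~ v)); rewrite -!compA uv.1 !comp_idr. Qed.
End InverseHoms.

Section CategoricalNotions.
Variable C : category.

(* In a module category the constant morphisms are the zero morphisms. *)
Definition constant_hom (X Y : C) (f : hom X Y) : Prop :=
  forall (W : C) (a b : hom W X), comp f a = comp f b.

Definition monic (X Y : C) (f : hom X Y) : Prop :=
  forall (W : C) (a b : hom W X), comp f a = comp f b -> a = b.

Definition simple_object (X : C) : Prop :=
  ~ constant_hom (idm X) /\
  forall (Y : C) (f : hom X Y), constant_hom f \/ monic f.

Definition kernel_of (X1 X X0 : C) (i : hom X1 X) (p : hom X X0) : Prop :=
  monic i /\
  forall (W : C) (g : hom W X), constant_hom (comp p g) ->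
    exists h : hom W X1, g = comp i h.

(** For simple modules, the triviality of all maps X1 -> X0 says that the two are not isomorphic. *)
Definition simple_ext_split : Prop :=
  forall (X1 X X0 : C) (i : hom X1 X) (p : hom X X0),
    simple_object X1 -> simple_object X0 ->
    (forall f : hom X1 X0, constant_hom f) -> kernel_of i p ->
    exists r : hom X X1, comp r i = idm X1.
End CategoricalNotions.

Section EquivalenceTransport.
Variables (C D : category) (F : functor C D) (G : functor D C).

Lemma nat_iso_faithful (X Y : C) (f g : hom X Y) :
  nat_iso (comp_functor G F) (id_functor C) -> fmap F f = fmap F g -> f = g.
Proof.
move=> [a [b [nat ba ab]]] fg.
apply: (comp_cancel_r (conj (ab X) (ba X))).
by have := nat X Y f; have := nat X Y g; rewrite /= fg => <- <-.
Qed.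
End EquivalenceTransport.

Lemma nat_iso_full (C D : category) (F : functor C D) (G : functor D C)
    (X Y : C) (h : hom (F X) (F Y)) :
  nat_iso (comp_functor G F) (id_functor C) ->
  nat_iso (comp_functor F G) (id_functor D) ->
  exists f : hom X Y, fmap F f = h.
Proof.
move=> [a [b [nat ba ab]]] FG.
exists (comp (a Y) (comp (fmap G h) (b X))); apply: (nat_iso_faithful FG).
apply: (comp_cancel_l (conj (ab Y) (ba Y))).
have /= -> := nat X Y (comp (a Y) (comp (fmap G h) (b X))).
by rewrite -!compA (ba X) comp_idr.
Qed.

Record equivalence_functor (C D : category) (F : functor C D) : Prop := {
  equiv_faithful : forall (X Y : C) (f g : hom X Y), fmap F f = fmap F g -> f = g;
  equiv_full : forall (X Y : C) (h : hom (F X) (F Y)), exists f, fmap F f = h;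
  equiv_surj : forall Y : D, exists (X : C) (u : hom (F X) Y) v, inverse_homs u v
}.

Lemma cat_equivalent_functor (C D : category) :
  cat_equivalent C D -> exists F : functor C D, equivalence_functor F.
Proof.
move=> [F [G [GF FG]]]; exists F; split=> [X Y f g|X Y h|Y].
- exact: nat_iso_faithful GF.
- exact: nat_iso_full GF FG.
have [a [b [_ ba ab]]] := FG; exists (G Y), (a Y), (b Y).
by split; [apply: ab|apply: ba].
Qed.

Section Transport.
Variables (C D : category) (F : functor C D).
Hypothesis Feq : equivalence_functor F.

Lemma equiv_generator (P : C) :
  commutative_generator P -> commutative_generator (F P).
Proof.
move=> [Pgen Pcomm]; split=> [X Y f g fg|a b].
  have [X' [u [u' uu']]] := equiv_surj Feq X.
  have [Y' [v [v' vv']]] := equiv_surj Feq Y.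
  have [f' Ff'] := equiv_full Feq (comp v' (comp f u)).
  have [g' Fg'] := equiv_full Feq (comp v' (comp g u)).
  apply: (comp_cancel_r uu'); apply: (comp_cancel_l (inverse_homs_sym vv')).
  rewrite -Ff' -Fg'; congr fmap; apply: Pgen => h; apply: (equiv_faithful Feq).
  by rewrite !fmap_comp Ff' Fg' -!compA fg.
have [a' <-] := equiv_full Feq a; have [b' <-] := equiv_full Feq b.
by rewrite -!fmap_comp Pcomm.
Qed.

(** Objects of D are values of F only up to isomorphism; [v] absorbs this on the target side. *)
Lemma equiv_constant (X Y : C) (f : hom X Y) (Z : D) (v : hom (F Y) Z) :
  constant_hom f -> constant_hom (comp v (fmap F f)).
Proof.
move=> fc W a b; have [W' [u [u' uu']]] := equiv_surj Feq W.
have [a' Fa'] := equiv_full Feq (comp a u).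
have [b' Fb'] := equiv_full Feq (comp b u).
apply: (comp_cancel_r uu'); rewrite -!compA -Fa' -Fb' -!fmap_comp.
by rewrite (fc _ a' b').
Qed.

Lemma equiv_constant_inv (X Y : C) (f : hom X Y) :
  constant_hom (fmap F f) -> constant_hom f.
Proof.
by move=> fc W a b; apply: (equiv_faithful Feq); rewrite !fmap_comp; apply: fc.
Qed.

Lemma equiv_monic (X Y : C) (f : hom X Y) : monic f -> monic (fmap F f).
Proof.
move=> fm W a b ab; have [W' [u [u' uu']]] := equiv_surj Feq W.
have [a' Fa'] := equiv_full Feq (comp a u).
have [b' Fb'] := equiv_full Feq (comp b u).
apply: (comp_cancel_r uu'); rewrite -Fa' -Fb'; congr fmap; apply: fm.
by apply: (equiv_faithful Feq); rewrite !fmap_comp Fa' Fb' !compA ab.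
Qed.

Lemma equiv_simple (X : C) : simple_object X -> simple_object (F X).
Proof.
move=> [Xid Xs]; split=> [FXid|Y f].
  by apply/Xid/equiv_constant_inv; rewrite fmap_id.
have [Y' [v [v' vv']]] := equiv_surj Feq Y.
have [f' Ff'] := equiv_full Feq (comp v' f).
have fE : f = comp v (fmap F f') by rewrite Ff' compA vv'.1 comp_idl.
have [f'c|f'm] := Xs _ f'; [left|right].
  by rewrite fE; apply: equiv_constant.
move=> W a b; rewrite fE -!compA => /(comp_cancel_l vv').
exact: equiv_monic.
Qed.

Lemma equiv_kernel (X1 X X0 : C) (i : hom X1 X) (p : hom X X0) :
  kernel_of i p -> kernel_of (fmap F i) (fmap F p).
Proof.
move=> [im ip]; split=> [|W g gc]; first exact: equiv_monic.
have [W' [u [u' uu']]] := equiv_surj Feq W.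
have [g' Fg'] := equiv_full Feq (comp g u).
have [|h g'E] := ip _ g'.
  apply: equiv_constant_inv; rewrite fmap_comp Fg' compA => W2 a b.
  by have := gc _ (comp u a) (comp u b); rewrite -!compA.
exists (comp (fmap F h) u'); apply: (comp_cancel_r uu').
by rewrite -Fg' g'E fmap_comp -!compA uu'.2 comp_idr.
Qed.

Lemma equiv_simple_ext_split : simple_ext_split D -> simple_ext_split C.
Proof.
move=> Ds X1 X X0 i p X1s X0s X10 ker.
have [f|r ri] := Ds _ _ _ _ _ (equiv_simple X1s) (equiv_simple X0s) _ (equiv_kernel ker).
  have [f' <-] := equiv_full Feq f; rewrite -[fmap F f']comp_idl.
  exact/equiv_constant/X10.
have [r' Fr'] := equiv_full Feq r; exists r'; apply: (equiv_faithful Feq).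
by rewrite fmap_comp Fr' ri fmap_id.
Qed.
End Transport.

(** * Simple modules over a commutative ring *)

Section CommutativeModules.
Variable R : pzRingType.
Hypothesis R_comm : forall r s : R, r * s = s * r.

Section ScalarMaps.
Variable X : lmodType R.

Definition scale_at (x : X) (r : R^o) : X := (r : R) *: x.
Fact scale_at_linear x : linear (scale_at x).
Proof. by move=> a r s; rewrite /scale_at scalerDl scalerA. Qed.
HB.instance Definition _ x :=
  GRing.isLinear.Build R R^o X *:%R (scale_at x) (scale_at_linear x).

Definition scale_by (a : R) (x : X) : X := a *: x.
Fact scale_by_linear a : linear (scale_by a).
Proof. by move=> k x y; rewrite /scale_by scalerDr !scalerA R_comm. Qed.
HB.instance Definition _ a :=
  GRing.isLinear.Build R X X *:%R (scale_by a) (scale_by_linear a).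
End ScalarMaps.

Lemma constant_hom0 (X Y : mod_cat R) (f : {linear X -> Y}) :
  constant_hom (f : hom X Y) -> forall x, f x = 0.
Proof.
move=> fc x; have := fc (R^o : lmodType R) (scale_at x : {linear _ -> _}) \0.
move=> /(congr1 (fun g : {linear R^o -> Y} => g 1)) /=.
by rewrite /scale_at scale1r raddf0.
Qed.

Lemma monic_inj (X Y : mod_cat R) (f : {linear X -> Y}) x :
  monic (f : hom X Y) -> f x = 0 -> x = 0.
Proof.
move=> fm fx; have := fm (R^o : lmodType R) (scale_at x : {linear _ -> _}) \0.
have -> : comp (f : hom X Y) (scale_at x : {linear R^o -> X}) =
          comp (f : hom X Y) (\0 : {linear R^o -> X}).
  by apply: linear_ext => r; rewrite /= /scale_at linearZ /= fx scaler0 raddf0.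
move=> /(_ erefl) /(congr1 (fun g : {linear R^o -> X} => g 1)) /=.
by rewrite /scale_at scale1r.
Qed.

(** The projection of X onto X / Rx kills x, so it is not monic; hence it is constant, that is zero,
    and X = Rx. *)
Lemma simple_object_cyclic (X : mod_cat R) : simple_object X ->
  forall x : X, x != 0 -> forall y : X, exists r : R, y = r *: x.
Proof.
move=> [_ Xs] x x0 y; pose S (y : X) := exists r : R, y = r *: x.
have [pc|pm] := Xs (module_quot S) (mproj S : {linear _ -> _}); last first.
  by case/eqP: x0; apply: (monic_inj pm); apply: mproj_gen; exists 1; rewrite scale1r.
have : span_of S y.
  by rewrite -[y]subr0; apply/mproj_eq; rewrite raddf0; apply: (constant_hom0 pc).
elim=> [//||a u v _ [r ->] _ [s ->]]; first by exists 0; rewrite scale0r.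
by exists (a * r + s); rewrite scalerDl scalerA.
Qed.

Lemma simple_object_neq0 (X : mod_cat R) :
  simple_object X -> exists x : X, x != 0.
Proof.
move=> [Xid _]; apply: contrapT => /forallNP X0; apply: Xid => W a b.
apply: linear_ext => w; transitivity (0 : X); last apply/esym.
  by have /negP/negPn/eqP := X0 (a w).
by have /negP/negPn/eqP := X0 (b w).
Qed.

(* A scalar e acting as 1 on X1 and as 0 on X0 maps X into the image of X1. *)
Lemma mod_cat_simple_ext_split : simple_ext_split (mod_cat R).
Proof.
move=> X1 X X0 i p X1s X0s X10 [im ip].
have [x1 x1n0] := simple_object_neq0 X1s; have [x0 x0n0] := simple_object_neq0 X0s.
have gen1 := simple_object_cyclic X1s x1n0.
(* Otherwise every scalar killing x1 kills x0, and r x1 |-> r x0 is a well-defined nonzero map X1 ->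
   X0, against [X10]. The function [rho] chooses the coefficients r. *)
have [a ax1 ax0] : exists2 a : R, a *: x1 = 0 & a *: x0 != 0.
  apply: contrapT => noa; have kill (a : R) : a *: x1 = 0 -> a *: x0 = 0.
    by move=> ax1; apply/eqP; apply: contrapT => /negP ax0; apply: noa; exists a.
  have /choice[rho rhoE] : forall y, exists r : R, y = r *: x1 by [].
  have f_lin : linear (fun y => rho y *: x0).
    move=> k y z; apply/eqP; rewrite -subr_eq0 scalerA -scalerDl -scalerBl.
    apply/eqP/kill; rewrite scalerBl scalerDl -scalerA -!rhoE.
    by rewrite subrr.
  pose fl := GRing.isLinear.Build R X1 X0 *:%R _ f_lin.
  pose f : {linear X1 -> X0} := HB.pack (fun y => rho y *: x0) fl.
  have := constant_hom0 (X10 f) x1; rewrite /=.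
  have /eqP : (rho x1 - 1) *: x0 = 0.
    by apply: kill; rewrite scalerBl -rhoE scale1r subrr.
  rewrite scalerBl scale1r subr_eq0 => /eqP -> /eqP.
  by rewrite (negPf x0n0).
have [b bax0] := simple_object_cyclic X0s ax0 x0.
(* The scalar b a kills x1 and fixes x0; commutativity carries this over to the modules that they
   generate. *)
pose e : R := 1 - b * a.
have e1 (y : X1) : e *: y = y.
  have [r ->] := gen1 y; rewrite scalerA R_comm -scalerA scalerBl -scalerA ax1.
  by rewrite scaler0 subr0 scale1r.
have e0 (y : X0) : e *: y = 0.
  have [r ->] := simple_object_cyclic X0s x0n0 y.
  rewrite scalerA R_comm -scalerA scalerBl -scalerA -bax0.
  by rewrite scale1r subrr scaler0.
(* Since p e = e p = 0, the scalar e factors as i r, and i r i = e i = i e = i. *)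
have [|r re] := ip X (scale_by e : {linear X -> X}).
  move=> W u v; apply: linear_ext => w; rewrite /= /scale_by.
  by rewrite !linearZ /= !e0.
exists r; apply: im; rewrite comp_idr compA -re.
by apply: linear_ext => y; rewrite /= /scale_by -linearZ e1.
Qed.
End CommutativeModules.

(** * n-Lie algebras and modules defined by determinants *)

Lemma det_rows_map (C D : comNzRingType) (f : {rmorphism C -> D}) m
    (x : 'I_m -> 'rV[C]_m) :
  f (det_rows x) = det_rows (map_mx f \o x).
Proof.
rewrite /det_rows -det_map_mx; congr (\det _).
by apply/matrixP => i j; rewrite !mxE.
Qed.

Lemma det_rows_expand (C : comNzRingType) m (x : 'I_m -> 'rV[C]_m) i (w : 'rV[C]_m) :
  det_rows (upd x i w) = \sum_k w 0 k * det_rows (upd x i (delta_mx 0 k)).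
Proof.
rewrite {1}[w]row_sum_delta multilinear_sum //; exact: det_rows_multilinear.
Qed.

(* The bracket det(x).v on C^n, restricted to a K-submodule W of C^n: taking C = K[t]
   or C = K (+) S gives the semidirect products of K^n with modules. *)
Section DetBracket.
Variables (K C : comNzRingType) (s : {rmorphism K -> C}) (m : nat).
Variables (W : lmodType K) (j : W -> 'rV[C]_m.+1) (v : 'rV[C]_m.+1).
Variable br : ('I_m.+1 -> W) -> W.
Hypotheses (j_inj : injective j)
  (jP : forall a u w, j (a *: u + w) = s a *: j u + j w)
  (brE : forall z, j (br z) = det_rows (j \o z) *: v).

Let j0 : j 0 = 0.
Proof. by have := jP (-1) 0 0; rewrite scaler0 addr0 rmorphN1 scaleN1r addNr. Qed.

Let j_sum I (r : seq I) (f : I -> W) : j (\sum_(i <- r) f i) = \sum_(i <- r) j (f i).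
Proof.
elim: r => [|i r IH]; first by rewrite !big_nil.
by rewrite !big_cons -[f i]scale1r jP rmorph1 IH !scale1r.
Qed.

(** The fundamental identity is Cramer's rule [det_rows_cramer] for v, under the linear form l(w) =
    det(w, y_1, ..., y_m); injectivity of [j] moves the computation to C^n. *)
Lemma det_bracket_nLie : is_nLie br.
Proof.
have dM := @det_rows_multilinear C m.+1.
split=> [x i a u w|x i k ik xik|x y]; apply: j_inj.
- by rewrite jP !brE !comp_upd jP dM scalerDl scalerA.
- by rewrite brE j0 (det_rows_alternating ik) ?scale0r //= xik.
pose l w := det_rows (cons_fam (n := m.+1) w (j \o y)).
have lM w u : l w = det_rows (upd (cons_fam (n := m.+1) u (j \o y)) ord0 w).
  by rewrite cons_fam_upd0.
have lZ a w : l (a *: w) = a * l w by rewrite !(lM _ 0) multilinear_updZ.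
have jl w : j (br (cons_fam (n := m.+1) w y)) = l (j w) *: v.
  by rewrite brE comp_cons_fam.
rewrite jl brE lZ j_sum.
transitivity (\sum_i (det_rows (upd (j \o x) i v) * l (j (x i))) *: v).
  rewrite -scaler_suml -lZ -(det_rows_cramer (j \o x) v); congr (_ *: _).
  rewrite (lM _ 0) multilinear_sum //; apply: eq_bigr => i _.
  by rewrite -lM.
apply: eq_bigr => i _; rewrite brE comp_upd jl multilinear_updZ //.
by rewrite [_ *: det_rows _]mulrC.
Qed.
End DetBracket.

(** The sign of the cycle on m + 1 places: [act] puts the module element last, whereas its
    coordinate comes first. *)
Lemma det_rows_cycle (C : comNzRingType) m :
  det_rows (rcons_fam (n := m.+1) (fun i : 'I_m => delta_mx 0 (lift ord0 i))
                      (delta_mx 0 ord0 : 'rV[C]_m.+1)) = (-1) ^+ m.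
Proof.
rewrite /det_rows (expand_det_row _ ord_max) (bigD1 ord0) //= big1 => [|k k0].
  rewrite addr0 !mxE rcons_fam_max mxE !eqxx mul1r /cofactor addn0.
  rewrite -[RHS]mulr1 -(det1 C m); congr (_ * \det _).
  apply/matrixP => i k; rewrite !mxE rcons_fam_lift mxE eqxx /=.
  by rewrite (inj_eq lift_inj) eq_sym.
by rewrite !mxE rcons_fam_max mxE (negPf k0) andbF mul0r.
Qed.

Section Action.
Variables (K : comNzRingType) (m : nat) (L : nLie K m.+1) (M : Lmodule L).

Lemma act_linear (x : 'I_m -> L) : linear (@act K m.+1 L M x).
Proof.
move=> a u w; have [brM _ _] := lmod_nLie M; rewrite /act.
rewrite -(rcons_fam_updmax _ (0 : M * L)).
have -> : (a *: u + w, 0) = a *: (u, 0) + (w, 0) :> M * L.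
  by congr (_, _); rewrite /= scaler0 addr0.
by rewrite brM /= !rcons_fam_updmax.
Qed.
HB.instance Definition _ (x : 'I_m -> L) :=
  GRing.isLinear.Build K M M *:%R (@act K m.+1 L M x) (act_linear x).

Lemma act_sum I (r : seq I) (x : 'I_m -> L) (a : I -> K) (f : I -> M) :
  @act K m.+1 L M x (\sum_(i <- r) a i *: f i) =
  \sum_(i <- r) a i *: @act K m.+1 L M x (f i).
Proof. by rewrite linear_sum; apply: eq_bigr => i _; rewrite linearZ. Qed.

Lemma act_multilinear (u : M) : multilinear (fun x : 'I_m -> L => @act K m.+1 L M x u).
Proof.
move=> x i a y z; have [brM _ _] := lmod_nLie M; rewrite /act.
have updE w : (fun k => (0, upd x i w k)) = upd (fun k => (0 : M, x k)) i (0, w).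
  by apply: funext => k; rewrite /upd; case: eqP.
rewrite !updE !(rcons_fam_upd (fun k => (0 : M, x k))).
have -> : (0, a *: y + z) = a *: (0, y) + (0, z) :> M * L.
  by congr (_, _); rewrite /= scaler0 addr0.
by rewrite brM.
Qed.

Lemma act_alternating (u : M) : alternating (fun x : 'I_m -> L => @act K m.+1 L M x u).
Proof.
move=> x i k ik xik; have [_ brA _] := lmod_nLie M; rewrite /act.
rewrite (brA _ (lift ord_max i) (lift ord_max k)) ?(inj_eq lift_inj) //.
by rewrite !(rcons_fam_lift (fun k => (0 : M, x k))) xik.
Qed.
End Action.

Section TrivialModule.
Variables (K : comNzRingType) (m : nat) (L : nLie K m.+1) (N : lmodType K).

Definition trivial_bracket (z : 'I_m.+1 -> N * L) : N * L := (0, bracket (snd \o z)).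

Fact trivial_nLie : is_nLie trivial_bracket.
Proof.
have [brM brA brF] := bracket_nLie L.
split=> [x i a u w|x i k ik xik|x y].
- rewrite /trivial_bracket !comp_upd brM.
  by congr (_, _); rewrite /= scaler0 addr0.
- by rewrite /trivial_bracket (brA _ i k) //= xik.
have pairD : {morph (fun w : L => (0, w) : N * L) : u w / u + w >-> u + w}.
  by move=> u w; congr (_, _); rewrite /= addr0.
rewrite /trivial_bracket comp_cons_fam brF (big_morph _ pairD erefl).
by apply: eq_bigr => i _; rewrite comp_upd /= comp_cons_fam.
Qed.

Fact trivial_subalgebra (x : 'I_m.+1 -> L) :
  trivial_bracket (fun i => (0, x i)) = (0, bracket x).
Proof. by []. Qed.
Fact trivial_ideal (z : 'I_m.+1 -> N * L) i :
  (z i).2 = 0 -> (trivial_bracket z).2 = 0.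
Proof. by move=> zi; have [brM _ _] := bracket_nLie L; apply: multilinear_eq0 zi. Qed.
Fact trivial_abelian (z : 'I_m.+1 -> N * L) i k :
  i != k -> (z i).2 = 0 -> (z k).2 = 0 -> trivial_bracket z = 0.
Proof. by move=> _ zi _; congr (_, _); apply: trivial_ideal zi. Qed.

Definition trivial_module : Lmodule L :=
  LModule trivial_nLie trivial_subalgebra trivial_ideal trivial_abelian.

Lemma act_trivial (x : 'I_m -> L) (u : trivial_module) :
  @act K m.+1 L trivial_module x u = 0.
Proof. by []. Qed.
End TrivialModule.

(** * Abelian n-Lie algebras *)

(* The free module K[t] on one generator over the abelian n-Lie algebra
   K^(n-1), where x_1 /\ ... /\ x_(n-1) acts as det(x).t. *)
Section PolyModule.
Variables (K : comNzRingType) (m : nat).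

Let L : nLie K m.+1 := abelian m.+1 'rV[K]_m.

Definition poly_row (w : {poly K} * L) : 'rV[{poly K}]_m.+1 :=
  \row_k (if unlift ord0 k is Some i then (w.2 0 i)%:P else w.1).

(** The factor (-1)^m cancels the sign of [det_rows_cycle], so that the standard basis acts as
    multiplication by ['X]. *)
Definition poly_bracket (z : 'I_m.+1 -> {poly K} * L) : {poly K} * L :=
  ((-1) ^+ m * 'X * det_rows (poly_row \o z), 0).

Fact poly_row0 p : poly_row (p, 0) = p *: delta_mx 0 ord0.
Proof.
apply/rowP => k; rewrite !mxE eqxx /=; case: unliftP => [i|] -> /=.
  by rewrite mxE polyC0 mulr0.
by rewrite mulr1.
Qed.

Fact poly_rowP a u w : poly_row (a *: u + w) = a%:P *: poly_row u + poly_row w.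
Proof.
apply/rowP => k; rewrite !mxE; case: unliftP => [i|] _ /=.
  by rewrite !mxE polyCD polyCM.
by rewrite mul_polyC.
Qed.

Fact poly_row_inj : injective poly_row.
Proof.
move=> [p x] [q y] e; congr (_, _).
  by have := congr1 (fun r : 'rV_m.+1 => r 0 ord0) e; rewrite !mxE unlift_none.
apply/rowP => i; have := congr1 (fun r : 'rV_m.+1 => r 0 (lift ord0 i)) e.
by rewrite !mxE liftK /= => /polyC_inj.
Qed.

Fact poly_bracket_nLie : is_nLie poly_bracket.
Proof.
apply: (det_bracket_nLie (s := polyC) (v := ((-1) ^+ m * 'X) *: delta_mx 0 ord0) poly_row_inj).
  exact: poly_rowP.
by move=> z; rewrite poly_row0 scalerA mulrC.
Qed.

Fact poly_subalgebra (x : 'I_m.+1 -> L) :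
  poly_bracket (fun i => (0, x i)) = (0, bracket x).
Proof.
congr (_, _); rewrite /det_rows (expand_det_col _ ord0) big1 ?mulr0 // => i _.
by rewrite !mxE unlift_none mul0r.
Qed.

Fact poly_ideal (z : 'I_m.+1 -> {poly K} * L) i :
  (z i).2 = 0 -> (poly_bracket z).2 = 0.
Proof. by []. Qed.

Fact poly_abelian (z : 'I_m.+1 -> {poly K} * L) i k :
  i != k -> (z i).2 = 0 -> (z k).2 = 0 -> poly_bracket z = 0.
Proof.
move=> ik zi zk; congr (_, _); have dM := @det_rows_multilinear {poly K} m.+1.
have rowE l : (z l).2 = 0 -> poly_row (z l) = (z l).1 *: delta_mx 0 ord0.
  by move=> zl; rewrite -poly_row0 -zl -surjective_pairing.
rewrite -(upd_id (poly_row \o z) i) /= rowE // multilinear_updZ //.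
set y := upd _ i _; rewrite -(upd_id y k) [y k]upd_neq 1?eq_sym //= rowE //.
rewrite multilinear_updZ // (det_rows_alternating ik) ?scaler0 ?mulr0 //.
by rewrite upd_eq upd_neq // /y upd_eq.
Qed.

Definition poly_module : Lmodule L :=
  LModule poly_bracket_nLie poly_subalgebra poly_ideal poly_abelian.

Let e (i : 'I_m) : L := delta_mx 0 i.

Lemma act_abelian (M : Lmodule L) (x : 'I_m -> L) (u : M) :
  @act K m.+1 L M x u = det_rows x *: @act K m.+1 L M e u.
Proof.
apply: (@alternating_det K m M (fun x => @act K m.+1 L M x u)).
  exact (act_multilinear (M := M) u).
exact (act_alternating (M := M) u).
Qed.

Lemma act_poly_basis (p : poly_module) :
  @act K m.+1 L poly_module e p = 'X * (p : {poly K}).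
Proof.
rewrite /act /= /poly_bracket comp_rcons_fam /= poly_row0.
have -> : poly_row \o (fun i => (0, e i)) =
          fun i : 'I_m => delta_mx 0 (lift ord0 i) : 'rV[{poly K}]_m.+1.
  apply: funext => i; apply/rowP => k; rewrite !mxE eqxx /=.
  case: unliftP => [l|] -> /=; last by rewrite ?(negPf (neq_lift _ _)).
  by rewrite mxE eqxx (inj_eq lift_inj) polyC_natr.
rewrite -(rcons_fam_updmax _ (0 : 'rV__)) multilinear_updZ; last exact: det_rows_multilinear.
rewrite rcons_fam_updmax det_rows_cycle -[_ *: _]/(_ * _).
by rewrite [p * _]mulrC mulrACA -expr2 sqrr_sign mul1r.
Qed.

Section PolyAction.
Variables (M : Lmodule L) (u : M).
Let tau : M -> M := @act K m.+1 L M e.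

(** Evaluation p(tau) u. By [act_abelian] every action is a multiple of tau, so commuting with tau
    suffices for a homomorphism. *)
Definition poly_action (p : poly_module) : M :=
  \sum_(i < size (p : {poly K})) (p : {poly K})`_i *: iter i tau u.

Fact poly_action_wide N (p : {poly K}) : (size p <= N)%N ->
  poly_action p = \sum_(i < N) p`_i *: iter i tau u.
Proof.
move=> pN; rewrite /poly_action (big_ord_widen _ (fun i => p`_i *: iter i tau u) pN).
rewrite big_mkcond; apply: eq_bigr => i _; case: ltnP => // pi.
by rewrite nth_default // scale0r.
Qed.

Fact poly_action_linear : linear poly_action.
Proof.
move=> a p q; pose N := maxn (size (p : {poly K})) (size (q : {poly K})).
rewrite (@poly_action_wide N p) ?leq_maxl // (@poly_action_wide N q) ?leq_maxr //.
rewrite (@poly_action_wide N).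
  rewrite scaler_sumr -big_split; apply: eq_bigr => i _.
  by rewrite coefD coefZ scalerDl scalerA.
apply: leq_trans (size_polyD _ _) _.
by rewrite geq_max leq_maxr andbT (leq_trans (size_scale_leq _ _)) ?leq_maxl.
Qed.
HB.instance Definition _ :=
  GRing.isLinear.Build K poly_module M *:%R poly_action poly_action_linear.

Fact poly_actionX (p : {poly K}) : poly_action ('X * p) = tau (poly_action p).
Proof.
rewrite (@poly_action_wide (size p).+1).
  rewrite big_ord_recl coefXM scale0r add0r /poly_action [RHS]act_sum.
  by apply: eq_bigr => i _; rewrite coefXM.
by rewrite (leq_trans (size_polyMleq _ _)) // size_polyX.
Qed.

Fact poly_action_act (x : 'I_m.+1.-1 -> L) p :
  poly_action (act x p) = act x (poly_action p).
Proof.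
rewrite (act_abelian x) (act_abelian x (poly_action p)) linearZ act_poly_basis.
by rewrite /= poly_actionX.
Qed.

Definition poly_action_hom : Lmodule_hom poly_module M :=
  LModuleHom poly_action_act.

Fact poly_action1 : poly_action 1 = u.
Proof. by rewrite /poly_action size_poly1 big_ord1 coef1 scale1r. Qed.
End PolyAction.

Lemma poly_module_endo (f : Lmodule_hom poly_module poly_module) (p : {poly K}) :
  f p = p * (f 1 : {poly K}).
Proof.
elim/poly_ind: p => [|p c IH]; first by rewrite raddf0 mul0r.
have fX : f ('X * p) = 'X * (f p : {poly K}).
  by have := lmod_hom_act f e p; rewrite !act_poly_basis.
have -> : p * 'X + c%:P = c *: 1 + 'X * p by rewrite addrC mulrC alg_polyC.
rewrite linearD linearZ /= fX IH mulrDl -scalerAl mul1r.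
by rewrite mulrA.
Qed.

Lemma poly_module_generator :
  @commutative_generator (Lmodule_cat L) poly_module.
Proof.
split=> [X Y f g fg|f g].
  apply: Lmodule_hom_ext => u; rewrite -(poly_action1 u).
  by have := congr1 (fun h : Lmodule_hom poly_module Y => h 1) (fg (poly_action_hom u)).
apply: Lmodule_hom_ext => p; rewrite /= (poly_module_endo f) (poly_module_endo g p).
by rewrite (poly_module_endo g (f p)) (poly_module_endo f p) mulrAC.
Qed.
End PolyModule.

(** * The square-zero extension and simple modules *)

Section SquareZeroExtension.
Variables (K : comNzRingType) (S : lmodType K).

Definition sqz_ext : Type := (K * S)%type.
HB.instance Definition _ := GRing.Zmodule.on sqz_ext.

Definition sqz_mul (p q : sqz_ext) : sqz_ext := (p.1 * q.1, p.1 *: q.2 + q.1 *: p.2).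

Fact sqz_mulA : associative sqz_mul.
Proof.
move=> [a s] [b t] [c u]; congr (_, _); rewrite /= ?mulrA //.
by rewrite !scalerDr !scalerA addrA [c * a]mulrC [b * c]mulrC.
Qed.
Fact sqz_mulC : commutative sqz_mul.
Proof. by move=> [a s] [b t]; congr (_, _); rewrite /= 1?mulrC // addrC. Qed.
Fact sqz_mul1 : left_id (1 : K, 0) sqz_mul.
Proof. by move=> [a s]; rewrite /sqz_mul /= mul1r scale1r scaler0 addr0. Qed.
Fact sqz_mulDl : left_distributive sqz_mul +%R.
Proof.
move=> [a s] [b t] [c u]; congr (_, _); rewrite /= ?mulrDl //.
by rewrite scalerDl scalerDr addrACA.
Qed.
Fact sqz_one_neq0 : (1 : K, 0) != 0 :> sqz_ext.
Proof. by apply/eqP => -[/eqP]; rewrite oner_eq0. Qed.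
HB.instance Definition _ := GRing.Zmodule_isComNzRing.Build sqz_ext
  sqz_mulA sqz_mulC sqz_mul1 sqz_mulDl sqz_one_neq0.

Definition sqz_inj (k : K) : sqz_ext := (k, 0).
Fact sqz_inj_zmod_morphism : zmod_morphism sqz_inj.
Proof. by move=> a b; congr (_, _); rewrite /= subr0. Qed.
HB.instance Definition _ :=
  GRing.isZmodMorphism.Build K sqz_ext sqz_inj sqz_inj_zmod_morphism.
Fact sqz_inj_monoid_morphism : monoid_morphism sqz_inj.
Proof. by split=> // a b; congr (_, _); rewrite /= !scaler0 addr0. Qed.
HB.instance Definition _ :=
  GRing.isMonoidMorphism.Build K sqz_ext sqz_inj sqz_inj_monoid_morphism.

Definition sqz_proj (p : sqz_ext) : K := p.1.
Fact sqz_proj_zmod_morphism : zmod_morphism sqz_proj.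
Proof. by []. Qed.
HB.instance Definition _ :=
  GRing.isZmodMorphism.Build sqz_ext K sqz_proj sqz_proj_zmod_morphism.
Fact sqz_proj_monoid_morphism : monoid_morphism sqz_proj.
Proof. by []. Qed.
HB.instance Definition _ :=
  GRing.isMonoidMorphism.Build sqz_ext K sqz_proj sqz_proj_monoid_morphism.

Lemma sqz_mul_eps (s : S) (c : sqz_ext) : ((0, s) : sqz_ext) * c = (0, c.1 *: s).
Proof. by congr (_, _); rewrite /= ?mul0r // scale0r add0r. Qed.

Lemma sqz_sum_eps I (r : seq I) (f : I -> S) :
  \sum_(i <- r) ((0, f i) : sqz_ext) = (0, \sum_(i <- r) f i).
Proof.
have pairD : {morph (fun u : S => (0, u) : sqz_ext) : u w / u + w >-> u + w}.
  by move=> u w; congr (_, _); rewrite /= addr0.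
by rewrite (big_morph _ pairD erefl).
Qed.
End SquareZeroExtension.

Section SimpleModule.
Variable K : comNzRingType.

Lemma simple_module_exists : exists S : lmodType K,
  (exists s : S, s != 0) /\
  forall s : S, s != 0 -> forall t, exists k : K, t = k *: s.
Proof.
(* Membership of 0 is not demanded: Zorn's lemma also asks for the union of the empty chain, which
   is empty. It is recovered for M by maximality, as {0} would otherwise be larger. *)
pose proper_ideal (I : set K) := [/\ forall a x y, I x -> I y -> I (a * x + y) & ~ I 1].
have [M [[Mlin M1] Mmax]] : exists M, proper_ideal M /\
    forall N, (M `<` N)%classic -> ~ proper_ideal N.
  apply: Zorn_bigcup => Fam FamP Ftot; split=> [a x y [I FI Ix] [J FJ Jy]|[I FI]].
    have [IJ|JI] := Ftot I J FI FJ.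
      by exists J => //; apply: (FamP J FJ).1 => //; apply: IJ.
    by exists I => //; apply: (FamP I FI).1 => //; apply: JI.
  exact: (FamP I FI).2.
have M0 : M 0.
  apply: contrapT => M0; apply: (Mmax [set 0]%classic).
    have Mno x : ~ M x by move=> Mx; apply: M0; rewrite -(addNr x) -mulN1r; apply: Mlin.
    by split=> [x /Mno//|/(_ 0 erefl)/Mno].
  split=> [b x y -> ->|/= /eqP]; first by rewrite /= mulr0 addr0.
  by rewrite oner_eq0.
have MZ b x : M x -> M (b * x) by move=> Mx; rewrite -[b * x]addr0; apply: Mlin.
have spanM (x : K^o) : span_of (M : K^o -> Prop) x <-> M x.
  split=> [|Mx]; last exact: span_gen.
  by elim=> // a u v _ Mu _ Mv; apply: Mlin.
have mproj0 (x : K^o) : mproj (M : K^o -> Prop) x = 0 <-> M x.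
  by rewrite -spanM -[X in _ = X](raddf0 (mproj (M : K^o -> Prop))) mproj_eq subr0.
exists (module_quot (M : K^o -> Prop)); split.
  by exists (mproj (M : K^o -> Prop) 1); apply/eqP => /mproj0.
move=> s s0 t; rewrite -[s]mproj_repr -[t]mproj_repr; set y : K := generic_quotient.repr t.
move: (generic_quotient.repr s : K) (mproj_repr s) => x sE.
have Mx : ~ M x by move/mproj0; rewrite sE; apply/eqP.
(* N is the ideal M + Kx; it properly contains M and so contains 1, which makes x invertible modulo
   M. *)
pose N : set K := fun z => exists b, M (z - b * x).
have [b Mb] : N 1.
  apply: contrapT => N1; apply: (Mmax N).
    split=> [z Mz|NM]; first by exists 0; rewrite mul0r subr0.
    by apply: Mx; apply: NM; exists 1; rewrite mul1r subrr.
  split=> // a z w [b Mb] [c Mc]; exists (a * b + c).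
  rewrite mulrDl opprD addrACA -mulrA -mulrBr.
  exact: Mlin.
exists (y * b); apply/eqP; rewrite -subr_eq0 -linearZ -raddfB.
apply/eqP/mproj0; rewrite -[_ *: _]/(_ * _) -mulrA -[X in X - _]mulr1 -mulrBr.
exact: MZ.
Qed.
End SimpleModule.

Section DetModule.
Variables (K : comNzRingType) (m : nat).

Definition det_bracket (x : 'I_m.+1 -> 'rV[K]_m.+1) : 'rV[K]_m.+1 :=
  det_rows x *: delta_mx 0 ord0.

Fact det_nLie_subproof : is_nLie det_bracket.
Proof.
by apply: (det_bracket_nLie (s := idfun) (j := id) (v := delta_mx 0 ord0)).
Qed.

Definition det_nLie : nLie K m.+1 := NLie det_nLie_subproof.

(* A submodule of det_nLie (x) S containing e_0 (x) S, where tau gives the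
   coordinates and iota the inclusion of e_0 (x) S. With E = K (+) S, S^2 = 0, its
   semidirect product with K^n sits in E^n, where the bracket is again det.e_0. *)
Section Coordinates.
Variables (S N : lmodType K) (tau : 'I_m.+1 -> {linear N -> S}).
Hypothesis tau_inj : forall u w, (forall k, tau k u = tau k w) -> u = w.
Variable iota : {linear S -> N}.
Hypothesis tau_iota : forall k s, tau k (iota s) = if k == ord0 then s else 0.

Let E := sqz_ext S.

Definition module_row (w : N * det_nLie) : 'rV[E]_m.+1 :=
  \row_k ((w.2 : 'rV[K]_m.+1) 0 k, tau k w.1).

Definition module_bracket (z : 'I_m.+1 -> N * det_nLie) : N * det_nLie :=
  let d : E := det_rows (module_row \o z) in (iota d.2, d.1 *: delta_mx 0 ord0).

Fact module_row_inj : injective module_row.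
Proof.
move=> [u x] [w y] e; have ek k := congr1 (fun r : 'rV[E]_m.+1 => r 0 k) e.
congr (_, _); first by apply: tau_inj => k; have := ek k; rewrite !mxE => -[].
by apply/rowP => k; have := ek k; rewrite !mxE => -[].
Qed.

Fact module_rowP a u w :
  module_row (a *: u + w) = sqz_inj S a *: module_row u + module_row w.
Proof.
apply/rowP => k; rewrite !mxE; congr (_, _).
by rewrite /= scaler0 addr0 linearP.
Qed.

Fact module_nLie : is_nLie module_bracket.
Proof.
apply: (det_bracket_nLie (s := sqz_inj S) (v := delta_mx 0 ord0) module_row_inj).
  exact: module_rowP.
move=> z; apply/rowP => k; rewrite !mxE eqxx /= tau_iota.
case: (det_rows _) => a s /=; case: (k == ord0).
  by rewrite mulr1 mulr1.
by rewrite !mulr0.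
Qed.

Fact det_fst (z : 'I_m.+1 -> N * det_nLie) :
  (det_rows (module_row \o z)).1 = det_rows (fun i => (z i).2 : 'rV[K]_m.+1).
Proof.
rewrite -[LHS]/(sqz_proj _) det_rows_map; congr det_rows; apply: funext => i.
by apply/rowP => k; rewrite !mxE.
Qed.

Fact module_row_eps u : module_row (u, 0) = \row_k ((0, tau k u) : E).
Proof. by apply/rowP => k; rewrite !mxE. Qed.

(** Row i lies in the square-zero ideal S, so the other rows contribute only their K-components. A
    second row of this kind makes the determinant vanish, whence [module_abelian]. *)
Fact det_eps (x : 'I_m.+1 -> 'rV[E]_m.+1) i u : x i = module_row (u, 0) ->
  det_rows x = (0, \sum_k det_rows (upd (fun l => map_mx (@sqz_proj K S) (x l)) i
                                         (delta_mx 0 k)) *: tau k u).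
Proof.
move=> xi; have -> : det_rows x = det_rows (upd x i (module_row (u, 0))).
  by rewrite -xi upd_id.
rewrite module_row_eps det_rows_expand -sqz_sum_eps.
apply: eq_bigr => k _; rewrite mxE sqz_mul_eps.
congr (_, _ *: _); rewrite -[LHS]/(sqz_proj _) det_rows_map comp_upd.
by congr (det_rows (upd _ _ _)); apply/rowP => q; rewrite !mxE; case: (_ && _).
Qed.

Fact module_subalgebra (x : 'I_m.+1 -> det_nLie) :
  module_bracket (fun i => (0, x i)) = (0, bracket x).
Proof.
have rowE i : module_row (0, x i) = map_mx (@sqz_inj K S) (x i).
  by apply/rowP => k; rewrite !mxE linear0.
rewrite /module_bracket.
have -> : det_rows (module_row \o fun i => (0, x i)) = sqz_inj S (det_rows x).
  by rewrite det_rows_map; congr det_rows; apply: funext.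
by rewrite /= linear0.
Qed.

Fact module_ideal (z : 'I_m.+1 -> N * det_nLie) i :
  (z i).2 = 0 -> (module_bracket z).2 = 0.
Proof.
move=> zi; rewrite /= det_fst.
by rewrite (multilinear_eq0 (@det_rows_multilinear K m.+1) (i := i)) ?scale0r.
Qed.

Fact module_abelian (z : 'I_m.+1 -> N * det_nLie) i k :
  i != k -> (z i).2 = 0 -> (z k).2 = 0 -> module_bracket z = 0.
Proof.
move=> ik zi zk; rewrite /module_bracket (@det_eps _ i (z i).1); last first.
  by rewrite -zi -surjective_pairing.
rewrite big1 ?raddf0 /= => [|l _]; first by rewrite scale0r.
rewrite (multilinear_eq0 (@det_rows_multilinear K m.+1) (i := k)) ?scale0r //.
rewrite upd_neq 1?eq_sym //; apply/rowP => q; rewrite !mxE.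
by rewrite zk mxE.
Qed.

Definition det_module : Lmodule det_nLie :=
  LModule module_nLie module_subalgebra module_ideal module_abelian.

Lemma act_det_module (x : 'I_m -> det_nLie) (u : det_module) :
  @act K m.+1 det_nLie det_module x u =
  iota (\sum_k det_rows (rcons_fam (n := m.+1) (x : 'I_m -> 'rV[K]_m.+1)
                                   (delta_mx 0 k)) *: tau k u).
Proof.
rewrite /act /= (@det_eps _ ord_max u) /=; last by rewrite rcons_fam_max.
congr (iota _); apply: eq_bigr => k _; congr (_ *: _); congr det_rows.
rewrite -(rcons_fam_updmax _ (0 : 'rV__)); apply: funext => l.
rewrite /upd; case: eqP => // /eqP lmax.
case: (unliftP ord_max l) lmax => [q|] ->; last by rewrite eqxx.
by rewrite !rcons_fam_lift => _; apply/rowP => r; rewrite !mxE.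
Qed.
End Coordinates.
End DetModule.

(** * A nonsplit extension of simple modules *)

Section LmoduleCategoryTheory.
Variables (K : comNzRingType) (m : nat) (L : nLie K m.+1).

Fact zero_hom_act (X Y : Lmodule L) (x : 'I_m.+1.-1 -> L) (u : X) :
  (\0 : {linear X -> Y}) (act x u) = act x ((\0 : {linear X -> Y}) u).
Proof. by rewrite /= raddf0. Qed.

Definition zero_Lmodule_hom (X Y : Lmodule L) : Lmodule_hom X Y :=
  LModuleHom (@zero_hom_act X Y).

Lemma constant_Lmodule_hom (X Y : Lmodule_cat L) (f : Lmodule_hom X Y) :
  constant_hom (f : hom X Y) <-> forall u, f u = 0.
Proof.
split=> [fc u|f0 W a b]; last by apply: Lmodule_hom_ext => w; rewrite /= !f0.
have := fc X (Lmodule_id X) (zero_Lmodule_hom X X).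
by move=> /(congr1 (fun g : Lmodule_hom X Y => g u)) /=; rewrite raddf0.
Qed.

Lemma simple_Lmodule (X : Lmodule_cat L) :
  (exists s : X, s != 0) ->
  (forall s : X, s != 0 -> forall t : X, exists k : K, t = k *: s) ->
  simple_object X.
Proof.
move=> [s s0] Xs; split=> [/constant_Lmodule_hom /(_ s) /eqP|Y f].
  by apply/negP.
have [[u uf]|f0] := pselect (exists u : X, u != 0 /\ f u = 0).
  left; apply/constant_Lmodule_hom => t; have [u0 fu] := uf.
  by have [k ->] := Xs u u0 t; rewrite linearZ /= fu scaler0.
right=> W a b ab; apply: Lmodule_hom_ext => w; apply/eqP; rewrite -subr_eq0.
apply: contrapT => /negP abw; apply: f0; exists (a w - b w); split=> //.
rewrite raddfB; apply/eqP; rewrite subr_eq0; apply/eqP.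
exact: (congr1 (fun g : Lmodule_hom W Y => g w) ab).
Qed.
End LmoduleCategoryTheory.

Section NonsplitExtension.
Variables (K : comNzRingType) (p : nat).
Let m := p.+1.
Let L : nLie K m.+1 := det_nLie K m.
Variable S : lmodType K.
Hypothesis S_neq0 : exists s : S, s != 0.
Hypothesis S_simple : forall s : S, s != 0 -> forall t, exists k : K, t = k *: s.

Let one_ord : 'I_m.+1 := lift ord0 ord0.

Definition line_coord (k : 'I_m.+1) : {linear S -> S} :=
  if k == ord0 then (idfun : {linear S -> S}) else (\0 : {linear S -> S}).

Fact line_coord_inj u w : (forall k, line_coord k u = line_coord k w) -> u = w.
Proof. by move/(_ ord0). Qed.

Fact line_coord_id k s : line_coord k (idfun s) = if k == ord0 then s else 0.
Proof. by rewrite /line_coord; case: (k == ord0). Qed.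

Definition line_module : Lmodule L := det_module line_coord_inj line_coord_id.

Definition plane_coord (k : 'I_m.+1) : {linear (S * S)%type -> S} :=
  if k == ord0 then (fst : {linear (S * S)%type -> S})
  else if k == one_ord then (snd : {linear (S * S)%type -> S})
  else (\0 : {linear (S * S)%type -> S}).

Definition plane_inj (s : S) : S * S := (s, 0).
Fact plane_inj_linear : linear plane_inj.
Proof. by move=> a s t; congr (_, _); rewrite /= scaler0 addr0. Qed.
HB.instance Definition _ :=
  GRing.isLinear.Build K S (S * S)%type *:%R plane_inj plane_inj_linear.

Fact plane_coord_inj u w : (forall k, plane_coord k u = plane_coord k w) -> u = w.
Proof. by case: u w => [a b] [c d] e; rewrite (e ord0 : a = c) (e one_ord : b = d). Qed.

Fact plane_coord_inj0 k s :
  plane_coord k (plane_inj s) = if k == ord0 then s else 0.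
Proof. by rewrite /plane_coord; case: (k == ord0) => //; case: (k == one_ord). Qed.

Definition plane_module : Lmodule L := det_module plane_coord_inj plane_coord_inj0.

(** The action of x sends e_k (x) s to e_0 (x) (gamma x k) s. *)
Let gamma (x : 'I_m -> L) (k : 'I_m.+1) : K :=
  det_rows (rcons_fam (n := m.+1) (x : 'I_m -> 'rV[K]_m.+1) (delta_mx 0 k)).

Lemma act_line (x : 'I_m -> L) (s : line_module) :
  @act K m.+1 L line_module x s = gamma x ord0 *: s.
Proof.
rewrite /line_module act_det_module /= (bigD1 ord0) //= big1 ?addr0 // => k k0.
by rewrite /line_coord (negPf k0) scaler0.
Qed.

Lemma act_plane (x : 'I_m -> L) (u : plane_module) :
  @act K m.+1 L plane_module x u =
  (gamma x ord0 *: u.1 + gamma x one_ord *: u.2, 0).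
Proof.
rewrite /plane_module act_det_module /= (bigD1 ord0) //= (bigD1 one_ord) //=.
rewrite big1 ?addr0 // => k /andP[k0 k1].
by rewrite /plane_coord (negPf k0) (negPf k1) scaler0.
Qed.

(** The family e_1, ..., e_m acts on e_0 (x) S by a sign. With e_1 replaced by e_0, it kills e_0 (x)
    S but maps e_1 (x) S isomorphically onto it. *)
Let x0 (i : 'I_m) : L := delta_mx 0 (lift ord0 i).
Let x1 : 'I_m -> L := upd x0 ord0 (delta_mx 0 ord0).

Lemma gamma_x0 : gamma x0 ord0 = (-1) ^+ m.
Proof. exact: det_rows_cycle. Qed.

Lemma gamma_x1 : gamma x1 ord0 = 0 /\ gamma x1 one_ord = - (-1) ^+ m.
Proof.
have mn : lift ord_max (ord0 : 'I_m) != ord_max by rewrite eq_sym neq_lift.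
split.
  apply: (det_rows_alternating mn).
  by rewrite rcons_fam_lift rcons_fam_max /x1 upd_eq.
rewrite -gamma_x0 -(alternating_tperm (@det_rows_multilinear K m.+1)
  (@det_rows_alternating K m.+1) _ mn); congr det_rows; apply: funext => k /=.
case: tpermP => [->|->|/eqP k0 /eqP kmax].
- by rewrite rcons_fam_lift rcons_fam_max /x1 upd_eq.
- by rewrite rcons_fam_lift rcons_fam_max.
case: (unliftP ord_max k) k0 kmax => [i|] ->; last by rewrite eqxx.
by rewrite (inj_eq lift_inj) => i0 _; rewrite !rcons_fam_lift /x1 upd_neq.
Qed.

Let sub_map : {linear line_module -> plane_module} := plane_inj.
Let quo_map : {linear plane_module -> trivial_module L S} := snd.

Fact sub_act (x : 'I_m.+1.-1 -> L) u : sub_map (act x u) = act x (sub_map u).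
Proof. by rewrite act_line act_plane /= scaler0 addr0. Qed.
Fact quo_act (x : 'I_m.+1.-1 -> L) u : quo_map (act x u) = act x (quo_map u).
Proof. by rewrite act_plane. Qed.

Let sub_hom := LModuleHom sub_act.
Let quo_hom := LModuleHom quo_act.

Lemma plane_kernel : @kernel_of (Lmodule_cat L) _ _ _ sub_hom quo_hom.
Proof.
split=> [W a b ab|W g /constant_Lmodule_hom gc].
  apply: Lmodule_hom_ext => w.
  by have := congr1 (fun f : Lmodule_hom W plane_module => (f w).1) ab.
pose h : {linear (W : Lmodule L) -> line_module} :=
  (fst : {linear plane_module -> S}) \o (g : Lmodule_hom W plane_module).
have hP (x : 'I_m.+1.-1 -> L) w : h (act x w) = act x (h w).
  rewrite act_line /= lmod_hom_act act_plane /=.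
  by have /= -> := gc w; rewrite scaler0 addr0.
exists (LModuleHom hP : Lmodule_hom W line_module); apply: Lmodule_hom_ext => w.
by rewrite /= [LHS]surjective_pairing; have /= -> := gc w.
Qed.

Lemma det_nLie_not_split : ~ simple_ext_split (Lmodule_cat L).
Proof.
move=> /(_ line_module plane_module (trivial_module L S) sub_hom quo_hom).
have [s s0] := S_neq0.
case=> [|||| r ri]; [exact: simple_Lmodule|exact: simple_Lmodule| |exact: plane_kernel|].
  (* [x0] acts by a unit on the line and by 0 on the trivial module, so no nonzero map exists
     between them. *)
  move=> f; apply/constant_Lmodule_hom => u.
  have := lmod_hom_act (f : Lmodule_hom _ _) x0 u.
  rewrite act_line act_trivial linearZ gamma_x0 => /(congr1 ( *:%R ((-1) ^+ m))).
  by rewrite scaler0 scalerA -expr2 sqrr_sign scale1r.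
(* A retraction fixes the element of the line that [x1] makes out of (0, s), namely s up to sign;
   but [x1] acts as 0 on the line. *)
have := lmod_hom_act (r : Lmodule_hom plane_module line_module) x1 (0, s).
rewrite act_line act_plane gamma_x1.1 gamma_x1.2 /= !scale0r add0r.
have -> : (- (-1) ^+ m *: s, 0) = sub_hom (- (-1) ^+ m *: s) by [].
have riE t : (r : Lmodule_hom plane_module line_module) (sub_hom t) = t.
  exact: (congr1 (fun f : Lmodule_hom line_module line_module => f t) ri).
rewrite riE => /(congr1 ( *:%R (- (-1) ^+ m))).
rewrite scaler0 scalerA mulrNN -expr2 sqrr_sign scale1r => /eqP.
by rewrite (negPf s0).
Qed.
End NonsplitExtension.

(** The equivalences enter at two algebras: K^m, which through [generator_swap] makes every F L
    commutative, and the determinant algebra, where commutativity contradicts the nonsplit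
    extension. *)
Lemma no_adjoint_with_module_equivalence (K : comNzRingType) (m : nat)
    (F : functor (nLie_cat K m.+1) (alg_cat K)) :
  (1 < m)%N -> has_right_adjoint F ->
  ~ forall L : nLie K m.+1, cat_equivalent (Lmodule_cat L) (mod_cat (F L)).
Proof.
move=> m1 [G FG] Feq.
have [E Eeq] := cat_equivalent_functor (Feq (abelian m.+1 'rV[K]_m)).
have gen := equiv_generator Eeq (poly_module_generator K m).
have comm := adjunction_commutative m1 FG (generator_swap gen).
case: m m1 F G FG Feq E Eeq gen comm => [//|p] m1 F G FG Feq E Eeq gen comm.
have [S [S_neq0 S_simple]] := simple_module_exists K.
apply: (det_nLie_not_split (p := p) S_neq0 S_simple).
have [E' E'eq] := cat_equivalent_functor (Feq (det_nLie K p.+1)).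
exact: equiv_simple_ext_split E'eq (mod_cat_simple_ext_split (comm _)).
Qed.

(** * The associated algebra *)

Section ExtLift.
Variables (K : comNzRingType) (m : nat) (V W : lmodType K) (f : ('I_m -> V) -> W).
Hypotheses (fM : multilinear f) (fA : alternating f).

Definition ext_lift_free (g : {malg K[{ffun 'I_m -> V}]}) : W :=
  \sum_(x <- msupp g) mcoeff x g *: f x.

Fact ext_lift_freeEw (d : {fset {ffun 'I_m -> V}}) g : (msupp g `<=` d)%fset ->
  ext_lift_free g = \sum_(x <- d) mcoeff x g *: f x.
Proof.
move=> gd; rewrite [LHS](big_fset_incl _ gd) => //= x _ /mcoeff_outdom ->.
by rewrite scale0r.
Qed.

Fact ext_lift_free_linear : linear ext_lift_free.
Proof.
move=> a g h; pose d := (msupp (a *: g + h) `|` (msupp g `|` msupp h))%fset.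
have gd : (msupp g `<=` d)%fset by rewrite /d fsetUCA fsubsetUl.
have hd : (msupp h `<=` d)%fset by rewrite /d fsetUA fsubsetUr.
rewrite (@ext_lift_freeEw d) ?fsubsetUl // (ext_lift_freeEw gd) (ext_lift_freeEw hd).
rewrite scaler_sumr -big_split; apply: eq_bigr => x _.
by rewrite mcoeffD mcoeffZ scalerDl scalerA.
Qed.
HB.instance Definition _ :=
  GRing.isLinear.Build K {malg K[{ffun 'I_m -> V}]} W *:%R
    ext_lift_free ext_lift_free_linear.

Fact ext_lift_free_tuple x : ext_lift_free (free_tuple x) = f x.
Proof.
rewrite (ext_lift_freeEw msuppU_le) big_seq_fset1 mcoeffUU scale1r.
by congr f; apply: funext => i; rewrite ffunE.
Qed.

Fact ext_lift_subproof s : ext_rel s -> ext_lift_free s = 0.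
Proof.
case=> [x i a u v|x i j ij xij]; last by rewrite ext_lift_free_tuple (fA ij).
by rewrite linearB linearP /= !ext_lift_free_tuple fM subrr.
Qed.

Definition ext_lift : {linear ext_power m V -> W} := mod_lift ext_lift_subproof.

Lemma ext_liftE x : ext_lift (wedge x) = f x.
Proof. by rewrite /ext_lift mod_liftE /= ext_lift_free_tuple. Qed.
End ExtLift.

Section AlgebraModule.
Variables (K : comNzRingType) (A : algebra K).

(** An [algebra] carries only its unit map; this copy has the K-module structure needed to speak of
    multilinear maps into it. *)
Definition alg_mod : Type := A.
HB.instance Definition _ := GRing.Zmodule.on alg_mod.

Definition alg_scale (k : K) (a : alg_mod) : alg_mod := alg_unit A k * (a : A).

Fact alg_scaleA k l a : alg_scale k (alg_scale l a) = alg_scale (k * l) a.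
Proof. by rewrite /alg_scale rmorphM mulrA. Qed.
Fact alg_scale1 : left_id 1 alg_scale.
Proof. by move=> a; rewrite /alg_scale rmorph1 mul1r. Qed.
Fact alg_scaleDr : right_distributive alg_scale +%R.
Proof. by move=> k a b; rewrite /alg_scale mulrDr. Qed.
Fact alg_scaleDl a : {morph alg_scale^~ a : k l / k + l}.
Proof. by move=> k l; rewrite /alg_scale rmorphD mulrDl. Qed.
HB.instance Definition _ := GRing.Zmodule_isLmodule.Build K alg_mod
  alg_scaleA alg_scale1 alg_scaleDr alg_scaleDl.

Lemma alg_modZ k (a : A) : k *: (a : alg_mod) = alg_unit A k * a.
Proof. by []. Qed.
End AlgebraModule.

Section AssocAlgebraTheory.
Variables (K : comNzRingType) (m : nat) (L : nLie K m.+1).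

Lemma assoc_gen_multilinear :
  multilinear (fun x : 'I_m -> L => assoc_gen (n := m.+1) x : alg_mod (assoc_alg L)).
Proof.
move=> x i a u v; rewrite /assoc_gen /tensor_wedge wedge_multilinear alg_modZ.
by rewrite tensor_gen_linear rmorphD rmorphM alg_hom_unit.
Qed.

Lemma assoc_gen_alternating :
  alternating (fun x : 'I_m -> L => assoc_gen (n := m.+1) x : alg_mod (assoc_alg L)).
Proof.
move=> x i j ij xij; rewrite /assoc_gen /tensor_wedge (wedge_alternating ij) //.
have -> : tensor_gen (0 : ext_power m L) = 0.
  have := tensor_gen_linear (-1) (0 : ext_power m L) 0.
  by rewrite scaler0 addr0 rmorphN1 mulN1r addNr.
exact: rmorph0.
Qed.

Lemma assoc_gen_rel s : assoc_rel (@tensor_wedge K m.+1 L) s -> assoc_proj L s = 0.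
Proof. exact: alg_proj_gen. Qed.

Lemma assoc_lift (B : algebra K) (f : ('I_m -> L) -> alg_mod B) :
  multilinear f -> alternating f ->
  (forall s, assoc_rel (n := m.+1) (f : _ -> B) s -> s = 0) ->
  exists h : alg_hom (assoc_alg L) B, forall x, h (assoc_gen x) = f x.
Proof.
move=> fM fA f_rel; pose g : ext_power m L -> B := ext_lift fM fA.
have g_lin a u v : g (a *: u + v) = alg_unit B a * g u + g v by rewrite /g linearP.
have T_rel s : assoc_rel (@tensor_wedge K m.+1 L) s -> tensor_lift g_lin s = 0.
  apply: (assoc_rel_map (f := nLie_id L) (w' := f) (G := alg_id B)) => // x.
  by rewrite [LHS]tensor_liftE /g ext_liftE.
exists (alg_lift T_rel) => x.
by rewrite [LHS]alg_liftE [LHS]tensor_liftE /g ext_liftE.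
Qed.
End AssocAlgebraTheory.

(** The sum is, up to sign, the expansion along column 0 of the determinant with rows (l(x_i), x_i),
    which vanishes since these are m + 1 vectors in the image of K^m. For determinant characters the
    second relation of U comes down to this. *)
Lemma det_rows_plucker (K : comNzRingType) (m : nat) (l : 'rV[K]_m -> K)
    (x : 'I_m.+1 -> 'rV[K]_m) :
  (forall a u w, l (a *: u + w) = a * l u + l w) ->
  \sum_(i < m.+1) (-1) ^+ (m - i) * (det_rows (x \o lift i) * l (x i)) = 0.
Proof.
move=> lP; pose r (w : 'rV[K]_m) : 'rV[K]_m.+1 :=
  \row_k (if unlift ord0 k is Some j then w 0 j else l w).
have rP a u w : r (a *: u + w) = a *: r u + r w.
  by apply/rowP => k; rewrite !mxE; case: (unlift _ _) => [j|]; rewrite ?lP ?mxE.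
have : det_rows (r \o x) = 0.
  have -> : x = fun i => \sum_j x i 0 j *: delta_mx 0 j.
    by apply: funext => i; rewrite [LHS]row_sum_delta.
  apply: (alternating_eq0 (f := fun y => det_rows (r \o y))) => // [y i a u w|y i k ik yik].
    by rewrite !comp_upd rP det_rows_multilinear.
  by apply: (det_rows_alternating ik); rewrite /= yik.
rewrite /det_rows (expand_det_col _ ord0) => det0.
rewrite -[RHS](mulr0 ((-1) ^+ m)) -[X in _ = _ * X]det0 mulr_sumr; apply: eq_bigr => i _.
rewrite !mxE unlift_none /cofactor addn0.
have -> : (-1) ^+ (m - i) = (-1) ^+ m * (-1) ^+ i :> K.
  by rewrite -signr_odd oddB ?leq_ord // signr_addb !signr_odd.
rewrite -mulrA [l _ * _]mulrC -[in RHS]mulrA; congr (_ * (_ * (\det _ * _))).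
by apply/matrixP => k q; rewrite !mxE liftK.
Qed.

(** For m > 1 the wedge of m elements of K is zero, so all generators of U(K) vanish. *)
Lemma assoc_line_rigid (K : comNzRingType) (m : nat) (B : algebra K)
    (f g : alg_hom (assoc_alg (abelian m.+1 'rV[K]_1)) B) :
  (1 < m)%N -> f = g.
Proof.
move=> m1; apply: assoc_alg_ext => x.
have -> : assoc_gen x = 0; last by rewrite !rmorph0.
have -> : x = fun i => \sum_j (x i : 'rV[K]_1) 0 j *: delta_mx 0 j.
  by apply: funext => i; rewrite [LHS]row_sum_delta.
exact (alternating_eq0 (fun j => delta_mx 0 j : abelian m.+1 'rV[K]_1)
  (fun i => (x i : 'rV[K]_1) 0) (@assoc_gen_multilinear K m _)
  (@assoc_gen_alternating K m _) m1).
Qed.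

(* U(K) = K for n > 2 although U(K^(n-1)) has the distinct characters c.det, and
   K^(n-1) is a coproduct of copies of K. *)
Lemma assoc_functor_no_adjoint (K : comNzRingType) (m : nat) :
  (1 < m)%N -> ~ has_right_adjoint (assoc_functor K m.+1).
Proof.
case: m => [//|p] m1 [G FG]; pose m := p.+1.
pose L : nLie K m.+1 := abelian m.+1 'rV[K]_m.
pose f (c : K) (x : 'I_m -> L) : alg_mod (base_alg K) :=
  c * det_rows (x : 'I_m -> 'rV[K]_m).
have fM c : multilinear (f c).
  move=> x i a u v; rewrite alg_modZ /f (@det_rows_multilinear K m x i).
  by rewrite mulrDr -[_ *: _]/(_ * _) mulrCA.
have fA c : alternating (f c).
  by move=> x i j ij xij; rewrite /f (det_rows_alternating ij) // mulr0.
have f_rel c s : assoc_rel (n := m.+1) (f c : _ -> base_alg K) s -> s = 0.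
  case=> [x y|x y].
    (* The target is commutative and every remaining term has a zero bracket as an argument. *)
    rewrite [f c y * _]mulrC subrr sub0r big1 ?oppr0 // => i _.
    by rewrite (multilinear_eq0 (fM c) (i := i)) ?upd_eq.
  rewrite (multilinear_eq0 (fM c) (i := ord0)) // sub0r.
  apply/eqP; rewrite oppr_eq0; apply/eqP.
  rewrite -[RHS](mulr0 (c * c)) -[X in _ = _ * X](@det_rows_plucker K m
    (fun w => det_rows (cons_fam (n := m) w (y : 'I_p -> 'rV[K]_m))) x).
    rewrite mulr_sumr; apply: eq_bigr => i _.
    by rewrite [RHS]mulrCA; congr (_ * _); exact: mulrACA.
  move=> a u w; rewrite -(cons_fam_upd0 (y : 'I_p -> 'rV[K]_m) 0).
  by rewrite det_rows_multilinear !cons_fam_upd0.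
have [h0 h0E] := assoc_lift (fM 0) (fA 0) (@f_rel 0).
have [h1 h1E] := assoc_lift (fM 1) (fA 1) (@f_rel 1).
have h01 : h0 = h1.
  (* An adjunction makes the maps U(K) -> U(K^m) jointly epic, and rigidity of U(K) then identifies
     the two characters. *)
  apply: (@at_point_ext K m m1 _ _ FG L (base_alg K) h0 h1) => x a.
  set i := fmap _ _; suff: alg_comp h0 i = alg_comp h1 i.
    by move/(congr1 (fun h : alg_hom (assoc_alg _) (base_alg K) => h a)).
  exact: assoc_line_rigid.
have := h1E (fun i => delta_mx 0 i); rewrite -h01 h0E /f mul0r mul1r => /esym/eqP.
rewrite /det_rows (_ : \matrix_i _ = 1%:M) ?det1 ?oner_eq0 //.
by apply/matrixP => i j; rewrite !mxE eqxx eq_sym.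
Qed.

Lemma rmorph_commutator (R S : pzRingType) (f : {rmorphism R -> S}) a b c :
  f (a * b - b * a - c) = 0 -> f c = f a * f b - f b * f a.
Proof. by rewrite !rmorphB !rmorphM => /eqP; rewrite subr_eq0 => /eqP ->. Qed.

(** * The commutator Lie algebra as right adjoint for n = 2 *)

Section CommutatorLie.
Variable K : comNzRingType.

Section Bracket.
Variable A : algebra K.

Definition comm_bracket (x : 'I_2 -> alg_mod A) : alg_mod A :=
  (x ord0 : A) * x ord_max - (x ord_max : A) * x ord0.

Fact comm_nLie_subproof : is_nLie comm_bracket.
Proof.
have ord2 (i : 'I_2) : i = ord0 \/ i = ord_max.
  by case: i => [[|[|//]]] ?; [left|right]; apply: val_inj.
split=> [x i a u v|x i j ij xij|x y].
- rewrite alg_modZ /comm_bracket; have [->|->] := ord2 i; rewrite /upd /= !alg_modZ;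
    rewrite mulrDl mulrDr !mulrA -alg_central mulrBr !mulrA opprD !addrA; congr (_ + _);
    by rewrite addrAC.
- rewrite /comm_bracket; have [ei|ei] := ord2 i; have [ej|ej] := ord2 j;
    move: ij xij; rewrite ei ej ?eqxx // => _ ->; exact: subrr.
have lift00 : lift ord0 ord0 = ord_max :> 'I_2 by apply: val_inj.
have consE a : cons_fam (n := 2) a y ord_max = y ord0 by rewrite -lift00 cons_fam_lift.
rewrite big_ord_recl big_ord1 lift00 /comm_bracket /upd /= !consE !cons_fam0.
rewrite !mulrBl !mulrBr !mulrA !opprB.
have jacobi (V : zmodType) (p q r s t u : V) :
    t - s + (u - q) = p - q + (r - s) + (t - p + (u - r)).
  have tele (v w z : V) : v - w + (z - v) = z - w by rewrite addrC addrA subrK.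
  by rewrite [RHS]addrACA !tele addrACA [RHS]addrACA [- q - s]addrC.
exact: jacobi.
Qed.

Definition comm_nLie : nLie K 2 := NLie comm_nLie_subproof.
End Bracket.

Section Map.
Variables (A B : algebra K) (h : alg_hom A B).

Definition comm_map : comm_nLie A -> comm_nLie B := h.

Fact comm_map_linear : linear comm_map.
Proof.
move=> a u v; have : h (alg_unit A a * (u : A) + (v : A)) =
    alg_unit B a * h u + h v by rewrite rmorphD rmorphM alg_hom_unit.
by [].
Qed.
HB.instance Definition _ :=
  GRing.isLinear.Build K (comm_nLie A) (comm_nLie B) *:%R comm_map comm_map_linear.

Fact comm_map_bracket (x : 'I_2 -> comm_nLie A) :
  comm_map (bracket x) = bracket (comm_map \o x).
Proof. by rewrite /comm_map [LHS]rmorphB !rmorphM. Qed.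

Definition comm_nLie_hom : nLie_hom (comm_nLie A) (comm_nLie B) :=
  NLieHom comm_map_bracket.
End Map.

Fact comm_functor_id (A : algebra K) : comm_nLie_hom (alg_id A) = nLie_id (comm_nLie A).
Proof. exact: nLie_hom_ext. Qed.

Fact comm_functor_comp (A B C : algebra K) (g : alg_hom B C) (f : alg_hom A B) :
  comm_nLie_hom (alg_comp g f) = nLie_comp (comm_nLie_hom g) (comm_nLie_hom f).
Proof. exact: nLie_hom_ext. Qed.

Definition comm_functor : functor (alg_cat K) (nLie_cat K 2) :=
  @Functor (alg_cat K) (nLie_cat K 2) comm_nLie comm_nLie_hom
    comm_functor_id comm_functor_comp.

Section Transpose.
Variables (L : nLie K 2) (A : algebra K).

Let gen (x : L) : assoc_alg L := assoc_gen (n := 2) (fun _ : 'I_1 => x).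

Let genE (x : 'I_1 -> L) : assoc_gen (n := 2) x = gen (x ord0).
Proof. by congr assoc_gen; apply: funext => i; rewrite ord1. Qed.

Let gen_linear a u v : gen (a *: u + v) = alg_unit (assoc_alg L) a * gen u + gen v.
Proof.
have := @assoc_gen_multilinear K 1 L (fun=> 0) ord0 a u v.
by rewrite !genE !upd_eq.
Qed.

Let rconsE (z : 'I_2 -> L) :
  z = rcons_fam (n := 2) (fun _ : 'I_1 => z ord0) (z ord_max).
Proof.
apply: funext => i; case: (unliftP ord_max i) => [j|] ->.
  by rewrite rcons_fam_lift; congr z; apply: val_inj; rewrite (ord1 j).
by rewrite rcons_fam_max.
Qed.

Let gen_bracket (z : 'I_2 -> L) :
  gen (bracket z) = gen (z ord0) * gen (z ord_max) - gen (z ord_max) * gen (z ord0).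
Proof.
pose t (x : L) := tensor_wedge (n := 2) (fun _ : 'I_1 => x).
have : assoc_rel (@tensor_wedge K 2 L)
    (t (z ord0) * t (z ord_max) - t (z ord_max) * t (z ord0) - t (bracket z)).
  have := AssocCommutator (@tensor_wedge K 2 L)
    (fun _ : 'I_1 => z ord0) (fun _ : 'I_1 => z ord_max).
  rewrite -(rconsE z) (_ : \sum_(i < _) _ = t (bracket z)) // big_ord1.
  by congr tensor_wedge; apply: funext => i; rewrite (ord1 i) upd_eq.
move/(assoc_gen_rel (m := 1)); rewrite -![gen _]/(assoc_proj L (t _)).
exact: rmorph_commutator.
Qed.

Section Forward.
Variable h : alg_hom (assoc_alg L) A.

Definition transpose_fun (x : L) : comm_nLie A := h (gen x).
Fact transpose_linear : linear transpose_fun.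
Proof.
by move=> a u v; rewrite /transpose_fun gen_linear rmorphD rmorphM alg_hom_unit.
Qed.
HB.instance Definition _ :=
  GRing.isLinear.Build K L (comm_nLie A) *:%R transpose_fun transpose_linear.
Fact transpose_bracket (x : 'I_2 -> L) :
  transpose_fun (bracket x) = bracket (transpose_fun \o x).
Proof.
rewrite /transpose_fun gen_bracket.
apply: (rmorph_commutator (f := h) (a := gen (x ord0)) (b := gen (x ord_max))).
by rewrite subrr rmorph0.
Qed.

Definition transpose : nLie_hom L (comm_nLie A) := NLieHom transpose_bracket.
End Forward.

Lemma transpose_surj (g : nLie_hom L (comm_nLie A)) : exists h, transpose h = g.
Proof.
pose w (x : 'I_1 -> L) : alg_mod A := g (x ord0).
have wM : multilinear w.
  by move=> x i a u v; rewrite /w (ord1 i) !upd_eq linearP.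
have wA : alternating w by move=> x i j; rewrite (ord1 i) (ord1 j) eqxx.
have w_rel s : assoc_rel (n := 2) (w : _ -> A) s -> s = 0.
  have gE (z : 'I_2 -> L) : g (bracket z) = (g (z ord0) : A) * g (z ord_max)
      - (g (z ord_max) : A) * g (z ord0) by exact: nLie_hom_bracket.
  case=> [x y|x y].
    rewrite big_ord1 /w upd_eq gE rcons_fam_max.
    have -> : rcons_fam (n := 2) x (y ord0) ord0 = x ord0.
      rewrite -[RHS](rcons_fam_lift (x : 'I_1 -> L) (y ord0)).
      by congr rcons_fam; apply: val_inj.
    exact: subrr.
  have lift00 : lift ord0 ord0 = ord_max :> 'I_2 by apply: val_inj.
  have lift10 : lift ord_max ord0 = ord0 :> 'I_2 by apply: val_inj.
  (* For n = 2 the family y is empty and the second relation is the commutator rule again: its two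
     terms are -x_2 x_1 and x_1 x_2. *)
  rewrite big_ord_recl big_ord1 /w /= !cons_fam0 gE lift00 lift10.
  rewrite expr1 expr0 mul1r mulN1r [- _ + _]addrC; exact: subrr.
have [h hE] := assoc_lift wM wA w_rel; exists h; apply: nLie_hom_ext => x.
exact: hE.
Qed.

Lemma transpose_inj : injective transpose.
Proof.
move=> h h' hh'; apply: assoc_alg_ext => x; rewrite genE.
exact: (congr1 (fun g : nLie_hom L (comm_nLie A) => g (x ord0)) hh').
Qed.
End Transpose.

Lemma assoc_functor_adjoint : has_right_adjoint (assoc_functor K 2).
Proof.
exists comm_functor, transpose; split=> [L A|L L' A B f g h]; last first.
  apply: nLie_hom_ext => x /=; rewrite /transpose_fun /comm_map /=.
  by congr (g (h _)); rewrite [LHS](assoc_mapE f).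
pose inv g := projT1 (cid (transpose_surj (L := L) (A := A) g)).
have invK g : transpose (inv g) = g := projT2 (cid (transpose_surj g)).
by exists inv => // h; apply: transpose_inj; apply: invK.
Qed.
End CommutatorLie.

Theorem theorem4p8 (K : comNzRingType) (n : nat) (hn : (2 <= n)%N) :
  (has_right_adjoint (assoc_functor K n) <-> n = 2%N) /\
  ((2 < n)%N ->
   ~ exists F : functor (nLie_cat K n) (alg_cat K),
       has_right_adjoint F /\
       forall L : nLie K n,
         cat_equivalent (Lmodule_cat L) (mod_cat (F L))).
Proof.
split; last first.
  case: n hn => [//|m] _ m1 [F [FG Feq]].
  exact: (no_adjoint_with_module_equivalence m1 FG Feq).
split=> [|->]; last exact: assoc_functor_adjoint.
move: hn; rewrite leq_eqVlt => /orP[/eqP //|].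
case: n => [//|m] m1 adj; case: (assoc_functor_no_adjoint m1 adj).
Qed.
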